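(* Let $d\ge 2$, $\Delta>0$ and $\mathcal{D}:=\{A\in\mathbb{R}^{d\times d}:\det A=\Delta\}$. Let $K\subset\mathcal{D}$ be a compact set such that $\mathrm{rint}\,K^{qc}\neq\emptyset$. Further, assume that there exist $\epsilon>0$ and nonzero vectors $a,n\in\mathbb{R}^{d}$, $|n|=1$, such that $\mathbf{1}+a\otimes n\in\mathcal{D}$ and $$B(\mathbf{1}+a\otimes n,\epsilon)\cap\mathcal{D}\subset K^{qc}.$$ Then there exist an open ball $\Omega=B(0,r)\subset\mathbb{R}^{d}$, $r>0$, disjoint open sets $\Omega^{+},\Omega^{-}$ and a non-planar $(d-1)$-surface $\Gamma$ of class $C^{1}$ with $\Omega=\Omega^{+}\cup\Gamma\cup\Omega^{-}$ and $\Gamma=\Omega\cap\partial\Omega^{+}=\Omega\cap\partial\Omega^{-}$, and a deformation $z\in W^{1,\infty}(\Omega,\mathbb{R}^{d})$ such that $$Dz(x)=\begin{cases}Dy(x), & x\in\Omega^{+},\\ \mathbf{1}, & x\in\Omega^{-},\end{cases}$$ where $y\in C^{1}(\overline{\Omega^{+}},\mathbb{R}^{d})$ and $Dy(x)\in K^{qc}$ for all $x\in\overline{\Omega^{+}}$.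
   Context: $\mathbf{1}$ is the identity matrix, $(a\otimes n)_{ij}=a_in_j$, $|\cdot|$ on matrices is the Euclidean (Frobenius) norm and $B(A,\epsilon)$ is the corresponding open ball. $D$ denotes the (weak) gradient. For a compact set $L\subset\mathbb{R}^{d\times d}$, the quasiconvex hull $L^{qc}$ is the set of matrices $F\in\mathbb{R}^{d\times d}$ for which there exists a sequence $z^{j}$ uniformly bounded in $W^{1,\infty}(O,\mathbb{R}^d)$, $O\subset\mathbb{R}^d$ a bounded domain (the choice of which is immaterial), with $z^{j}\stackrel{\ast}{\rightharpoonup}Fx$ in $W^{1,\infty}(O,\mathbb{R}^d)$ and $Dz^{j}\to L$ in measure, meaning that for every open neighbourhood $U$ of $L$ in $\mathbb{R}^{d\times d}$, $\lim_{j\to\infty}\mathrm{meas}\{x\in O:Dz^j(x)\notin U\}=0$. $\mathrm{rint}\,K^{qc}$ denotes the interior of $K^{qc}$ relative to the set $\mathcal{D}$. For an open set $O\subset\mathbb{R}^d$, $C^{1}(\overline{O},\mathbb{R}^{d})$ consists of the maps $y\in C^1(O,\mathbb{R}^d)$ that can be extended to continuously differentiable maps on an open set containing $\overline{O}$; on $\overline O\setminus O$, $Dy$ denotes the continuous extension of $Dy$ from $O$. A $(d-1)$-surface $\Gamma$ is a relatively compact manifold of dimension $d-1$ embedded in $\mathbb{R}^{d}$ such that every point of $\Gamma$ has an open neighbourhood in $\Gamma$ homeomorphic to a ball in $\mathbb{R}^{d-1}$. It is of class $C^{1}$ if for each $\xi\in\Gamma$ there exist $r>0$, a Cartesian coordinate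 system in $B(\xi,r)$ with coordinates $(\bar{x},x_d)$, $\bar x=(x_1,\dots,x_{d-1})$, and a $C^{1}$ function $g:\mathbb{R}^{d-1}\to\mathbb{R}$ such that $\Gamma\cap B(\xi,r)=\{x\in B(\xi,r):x_d=g(\bar{x})\}$. Such a $\Gamma$ is called non-planar if its unit normal direction (taken up to sign) is not constant along $\Gamma$. *)

(* Defs.v *)
From HB Require Import structures.
From mathcomp Require Import all_boot all_order all_algebra.
From mathcomp Require Import all_classical all_reals all_analysis.

Set Implicit Arguments.
Unset Strict Implicit.
Unset Printing Implicit Defensive.
Import Order.TTheory GRing.Theory Num.Theory.
Import numFieldNormedType.Exports.

Local Open Scope classical_set_scope.
Local Open Scope ring_scope.

(* Conventions: points of R^d are row vectors 'rV[R]_d. The topology on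
   'M[R]_(m, n) is the library's (sup-norm) one, which is the Euclidean
   topology; metric notions use the Euclidean norm enorm below. *)

Section Euclidean.
Context {R : realType}.

Definition enorm m n (A : 'M[R]_(m, n)) : R :=
  Num.sqrt (\sum_i \sum_j A i j ^+ 2).

Definition eball m n (A : 'M[R]_(m, n)) (r : R) : set 'M[R]_(m, n) :=
  [set B | enorm (B - A) < r].

Definition tens d (a n : 'rV[R]_d) : 'M[R]_d :=
  \matrix_(i, j) (a 0 i * n 0 j).

Definition dotv d (u v : 'rV[R]_d) : R := \sum_i u 0 i * v 0 i.

Definition detset d (Delta : R) : set 'M[R]_d := [set A | \det A = Delta].

Definition frontier (T : topologicalType) (A : set T) : set T :=
  closure A `\` A°.

Definition rint (T : topologicalType) (D S : set T) : set T :=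
  [set F | D F /\ within D (nbhs F) S].

End Euclidean.

(* Lebesgue measure on R^d: Caratheodory restriction of the outer measure given
   by countable covers by half-open boxes. The index set I may be empty, so
   that set0 is null also when d = 0. *)
Section Lebesgue.
Context {R : realType}.
Local Open Scope ereal_scope.

Definition box d (c : 'rV[R]_d * 'rV[R]_d) : set 'rV[R]_d :=
  [set x | forall i, (c.1 0%R i < x 0%R i <= c.2 0%R i)%R].

Definition vol d (c : 'rV[R]_d * 'rV[R]_d) : R :=
  (\prod_i Num.max 0 (c.2 0 i - c.1 0 i))%R.

Definition lebo d (A : set 'rV[R]_d) : \bar R :=
  ereal_inf [set v | exists (I : set nat) (c : nat -> 'rV[R]_d * 'rV[R]_d),
    A `<=` \bigcup_(k in I) box (c k) /\ v = \esum_(k in I) (vol (c k))%:E].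

Lemma vol_ge0 d (c : 'rV[R]_d * 'rV[R]_d) : 0 <= (vol c)%:E.
Proof. by rewrite lee_fin; apply: prodr_ge0 => i _; rewrite le_max lexx. Qed.

Lemma lebo_ge0 d (A : set 'rV[R]_d) : 0 <= lebo A.
Proof.
apply: le_ereal_inf_tmp => _ [I [c [_ ->]]].
by apply: esum_ge0 => k _; exact: vol_ge0.
Qed.

Lemma lebo0 d : lebo (set0 : set 'rV[R]_d) = 0.
Proof.
apply/eqP; rewrite eq_le lebo_ge0 andbT; apply: ereal_inf_lbound.
exists set0, (fun=> (0%R, 0%R)); split; first by [].
by rewrite esum_set0.
Qed.

Lemma le_lebo d : {homo @lebo d : A B / A `<=` B >-> A <= B}.
Proof.
move=> A B AB; apply: ereal_inf_le_tmp => _ [I [c [cB ->]]].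
by exists I, c; split => //; exact: subset_trans cB.
Qed.

Lemma lebo_sigma_subadditive d : sigma_subadditive (@lebo d).
Proof.
move=> A; have [[i ioo]|] := pselect (exists i, lebo (A i) = +oo).
  rewrite (eseries_pinfty _ _ ioo) ?leey// => n _.
  by rewrite -ltNye (lt_le_trans _ (lebo_ge0 _)).
rewrite -forallNE => Aoo.
apply/lee_addgt0Pr => e e0.
apply: le_trans (epsilon_trick _ _ (ltW e0)); last by move=> n; exact: lebo_ge0.
pose P n (Ic : set nat * (nat -> 'rV[R]_d * 'rV[R]_d)) :=
  A n `<=` \bigcup_(k in Ic.1) box (Ic.2 k) /\
  \esum_(k in Ic.1) (vol (Ic.2 k))%:E <= lebo (A n) + (e / (2 ^ n.+1)%:R)%:E.
have [G PG] : {G : nat -> set nat * (nat -> 'rV[R]_d * 'rV[R]_d) &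
    forall n, P n (G n)}.
  apply: (@choice _ _ P) => n.
  have en : (0 < e / (2 ^ n.+1)%:R)%R.
    by rewrite divr_gt0// ltr0n expn_gt0.
  have fA : lebo (A n) \is a fin_num.
    by rewrite ge0_fin_numE ?lebo_ge0// ltey; apply/eqP; exact: Aoo.
  have [x [I [c [cA ->]]] /ltW cx] := lb_ereal_inf_adherent en fA.
  by exists (I, c).
pose Q := [set: nat] `*`` (fun n => (G n).1).
pose w (p : nat * nat) := (G p.1).2 p.2.
have w0 p : 0 <= (vol (w p))%:E by exact: vol_ge0.
pose c k := if @unpickle (nat * nat)%type k is Some p then w p else (0%R, 0%R).
have cK p : c (pickle p) = w p by rewrite /c pickleK.
have bijQ : set_bij Q (pickle @` Q) pickle.
  split; [by move=> p Qp; exists p|  |by []].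
  by move=> p q _ _; exact: (pcan_inj pickleK).
apply: (@le_trans _ _ (\esum_(p in Q) (vol (w p))%:E)).
  apply: ereal_inf_lbound; exists (pickle @` Q), c; split.
    move=> x [n _ /(PG n).1[k Gk bx]].
    exists (pickle (n, k)); first by exists (n, k).
    by rewrite cK.
  rewrite (reindex_esum Q (pickle @` Q) pickle _ bijQ); apply: eq_esum => p _.
  by rewrite cK.
rewrite -(@esum_esum _ _ _ _ _ (fun n k => (vol (w (n, k)))%:E))//.
rewrite -nneseries_esumT; last first.
  by move=> n; apply: esum_ge0 => k _; exact: w0.
apply: lee_nneseries => [n _ _|n _].
  by apply: esum_ge0 => k _; exact: w0.
exact: (PG n).2.
Qed.

HB.instance Definition _ d := isOuterMeasure.Build R 'rV[R]_d (@lebo d)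
  (@lebo0 d) (@lebo_ge0 d) (@le_lebo d) (@lebo_sigma_subadditive d).

End Lebesgue.

Definition leb_space (R : realType) d :=
  caratheodory_type (@lebo R d : set 'rV[R]_d -> \bar R).

HB.instance Definition _ (R : realType) d :=
  Measurable.copy (leb_space R d) (caratheodory_type (@lebo R d)).

Definition leb (R : realType) d (A : set (leb_space R d)) : \bar R := lebo A.

HB.instance Definition _ (R : realType) d :=
  isMeasure.Build _ (leb_space R d) R (@leb R d)
    (@caratheodory_measure0 R _ (@lebo R d))
    (@caratheodory_measure_ge0 R _ (@lebo R d))
    (@caratheodory_measure_sigma_additive R _ (@lebo R d)).

Section Differentiation.
Context {R : realType}.

Definition axis d (j : 'I_d) : 'rV[R]_d := delta_mx 0 j.

(* (Dy)_ij = d y_i / d x_j; the library's jacobian is the transpose. *)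
Definition grad d (y : 'rV[R]_d -> 'rV[R]_d) (x : 'rV[R]_d) : 'M[R]_d :=
  (jacobian y x)^T.

Definition C1_on d (W : normedModType R) (O : set 'rV[R]_d)
    (f : 'rV[R]_d -> W) : Prop :=
  forall x, O x -> differentiable f x /\
    forall j, {for x, continuous (fun u => 'D_(axis j) f u)}.

Fixpoint Ck d (k : nat) (f : 'rV[R]_d -> R) : Prop :=
  if k is k'.+1 then
    (forall x, differentiable f x) /\
    (forall j, Ck k' (fun u => 'D_(axis j) f u))
  else continuous f.

(* smooth with compact support in O *)
Definition test_fun d (O : set 'rV[R]_d) (phi : 'rV[R]_d -> R) : Prop :=
  (forall k, Ck k phi) /\
  exists S : set 'rV[R]_d,
    [/\ compact S, S `<=` O & forall x, ~ S x -> phi x = 0].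

Definition C1_closure d (O : set 'rV[R]_d) (y : 'rV[R]_d -> 'rV[R]_d) : Prop :=
  C1_on O y /\
  exists (V : set 'rV[R]_d) (Y : 'rV[R]_d -> 'rV[R]_d),
    [/\ open V, closure O `<=` V, C1_on V Y & forall x, O x -> Y x = y x].

Definition closure_grad d (O : set 'rV[R]_d) (y : 'rV[R]_d -> 'rV[R]_d)
    (x : 'rV[R]_d) : 'M[R]_d :=
  if x \in O then grad y x else lim (grad y @ within O (nbhs x)).

End Differentiation.

Section Sobolev.
Context {R : realType}.

Definition weak_gradient d (O : set 'rV[R]_d)
    (z : 'rV[R]_d -> 'rV[R]_d) (G : 'rV[R]_d -> 'M[R]_d) : Prop :=
  forall phi, test_fun O phi -> forall i j,
    \int[@leb R d]_(x in O) (z x 0 i * 'D_(axis j) phi x) =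
    - \int[@leb R d]_(x in O) (G x i j * phi x).

(* z is in W^{1,oo}(O, R^d) with weak gradient G, |z| and |G| being bounded
   almost everywhere by M. *)
Definition W1oo_bound d (O : set 'rV[R]_d)
    (z : 'rV[R]_d -> 'rV[R]_d) (G : 'rV[R]_d -> 'M[R]_d) (M : R) : Prop :=
  [/\ forall i, measurable_fun (O : set (leb_space R d)) (fun x => z x 0 i),
      forall i j, measurable_fun (O : set (leb_space R d)) (fun x => G x i j),
      \forall x \ae @leb R d, O x -> enorm (z x) <= M /\ enorm (G x) <= M
    & weak_gradient O z G].

Definition W1oo d (O : set 'rV[R]_d)
    (z : 'rV[R]_d -> 'rV[R]_d) (G : 'rV[R]_d -> 'M[R]_d) : Prop :=
  exists M, W1oo_bound O z G M.

Definition Loo_weak_star d (O : set 'rV[R]_d)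
    (f : nat -> 'rV[R]_d -> R) (g : 'rV[R]_d -> R) : Prop :=
  forall h : 'rV[R]_d -> R, (@leb R d).-integrable O (EFin \o h) ->
    (\int[@leb R d]_(x in O) (f k x * h x)) @[k --> \oo] -->
    \int[@leb R d]_(x in O) (g x * h x).

Definition W1oo_weak_star d (O : set 'rV[R]_d)
    (z : nat -> 'rV[R]_d -> 'rV[R]_d) (G : nat -> 'rV[R]_d -> 'M[R]_d)
    (z0 : 'rV[R]_d -> 'rV[R]_d) (G0 : 'rV[R]_d -> 'M[R]_d) : Prop :=
  (forall i, Loo_weak_star O (fun k x => z k x 0 i) (fun x => z0 x 0 i)) /\
  (forall i j, Loo_weak_star O (fun k x => G k x i j) (fun x => G0 x i j)).

Definition cvg_to_set_in_measure d (O : set 'rV[R]_d)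
    (G : nat -> 'rV[R]_d -> 'M[R]_d) (L : set 'M[R]_d) : Prop :=
  forall U : set 'M[R]_d, open U -> L `<=` U ->
    @leb R d [set x | O x /\ ~ U (G k x)] @[k --> \oo] --> 0%E.

Definition bounded_domain d (O : set 'rV[R]_d) : Prop :=
  [/\ O !=set0, open O, connected O & bounded_set O].

(* L^qc; it does not depend on the bounded domain O. The row vector
   x *m F^T is the point F x. *)
Definition qc_hull d (O : set 'rV[R]_d) (L : set 'M[R]_d) : set 'M[R]_d :=
  [set F | exists (z : nat -> 'rV[R]_d -> 'rV[R]_d)
                  (G : nat -> 'rV[R]_d -> 'M[R]_d),
    [/\ exists M, forall k, W1oo_bound O (z k) (G k) M,
        W1oo_weak_star O z G (fun x => x *m F^T) (fun=> F)
      & cvg_to_set_in_measure O G L]].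

End Sobolev.

Section Surfaces.
Context {R : realType}.

Definition homeomorphic_sets (T U : topologicalType) (A : set T) (B : set U) :
    Prop :=
  exists (f : T -> U) (g : U -> T),
    [/\ {within A, continuous f}, {within B, continuous g},
        forall x, A x -> B (f x) /\ g (f x) = x
      & forall y, B y -> A (g y) /\ f (g y) = y].

(* Gam carries the topology induced by R^d, so the Hausdorff and second
   countability axioms of a manifold hold automatically. *)
Definition surface d (Gam : set 'rV[R]_d) : Prop :=
  compact (closure Gam) /\
  forall xi, Gam xi -> exists (V : set 'rV[R]_d) (c : 'rV[R]_d.-1) (rho : R),
    [/\ open V, V xi, 0 < rho & homeomorphic_sets (Gam `&` V) (eball c rho)].

(* Orthonormal axes of a Cartesian coordinate system: the rows of e are the
   first d-1 ones, nu is the last. *)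
Definition cartesian_axes d (e : 'M[R]_(d.-1, d)) (nu : 'rV[R]_d) : Prop :=
  [/\ e *m e^T = 1%:M, e *m nu^T = 0 & dotv nu nu = 1].

Definition C1_surface d (Gam : set 'rV[R]_d) : Prop :=
  surface Gam /\
  forall xi, Gam xi -> exists (r : R) (p : 'rV[R]_d) (e : 'M[R]_(d.-1, d))
      (nu : 'rV[R]_d) (g : 'rV[R]_d.-1 -> R),
    [/\ 0 < r, cartesian_axes e nu, C1_on setT (g : _ -> R)
      & Gam `&` eball xi r =
        [set x | eball xi r x /\ dotv (x - p) nu = g ((x - p) *m e^T)]].

Definition tangent d (Gam : set 'rV[R]_d) (xi tau : 'rV[R]_d) : Prop :=
  exists gam : R -> 'rV[R]_d,
    [/\ gam 0 = xi, \forall t \near 0, Gam (gam t) & is_derive (0 : R) (1 : R) gam tau].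

(* The tangent space at xi is the set of velocities at xi of curves in Gam. *)
Definition unit_normal d (Gam : set 'rV[R]_d) (xi N : 'rV[R]_d) : Prop :=
  enorm N = 1 /\ forall tau, tangent Gam xi tau -> dotv N tau = 0.

Definition non_planar d (Gam : set 'rV[R]_d) : Prop :=
  exists xi1 xi2 N1 N2 : 'rV[R]_d,
    [/\ Gam xi1 /\ Gam xi2, unit_normal Gam xi1 N1, unit_normal Gam xi2 N2,
        N1 <> N2 & N1 <> - N2].

End Surfaces.

(* Main.v *)
From HB Require Import structures.
Require Import Defs.
From mathcomp Require Import all_boot all_order all_algebra ring lra.
From mathcomp Require Import all_classical all_reals all_analysis.
From mathcomp Require Import measurable_realfun.

Set Implicit Arguments.
Unset Strict Implicit.
Unset Printing Implicit Defensive.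
Import Order.TTheory GRing.Theory Num.Theory.
Import numFieldNormedType.Exports.
Local Open Scope classical_set_scope.
Local Open Scope ring_scope.

(* Let w be a unit vector orthogonal to n and psi(x) = x + (x . w)^2 n, a
   polynomial diffeomorphism with det D psi = 1 and D psi(0) = 1. The map
   y = psi^-1 o (1 + a (x) n) o psi is the identity on the non-planar surface
   n . psi = 0, satisfies det Dy = Delta everywhere and Dy(0) = 1 + a (x) n; so
   on a small ball Dy stays in B(1 + a (x) n, eps), hence in K^qc. The
   deformation z equals y where n . psi > 0 and the identity elsewhere; it is
   locally Lipschitz.

   The weak gradient of z is obtained without Fubini's theorem and without
   showing that the surface is null: z has everywhere a limit of difference
   quotients along backward increments x - e_j / k, and discrete integration by
   parts (translation invariance of the Lebesgue measure) followed by dominated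
   convergence shows that this limit is its weak gradient. *)

(** * Lebesgue measure on R^d *)

Section LebesgueRd.
Context {R : realType} {d : nat}.
Implicit Types (A : set 'rV[R]_d) (i : 'I_d) (t : R).

(** The hyperplane [x_i = t] cuts each covering box into the half-open boxes [lo k] and [hi k],
    possibly empty, whose volumes add up. Every cover of [A] thus splits into covers of the two
    parts of [A], which gives Caratheodory's criterion. *)
Lemma measurable_halfspace i t :
  measurable ([set x | x 0 i <= t] : set (leb_space R d)).
Proof.
apply: (@le_caratheodory_measurable _ _ (@lebo R d)) => A.
apply: le_ereal_inf_tmp => _ [I [c [Ac ->]]].
pose lo k : 'rV[R]_d * 'rV[R]_d :=
  ((c k).1, \row_j if j == i then Num.min ((c k).2 0 i) t else (c k).2 0 j).
pose hi k : 'rV[R]_d * 'rV[R]_d :=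
  (\row_j if j == i then Num.max ((c k).1 0 i) t else (c k).1 0 j, (c k).2).
have -> : (\esum_(k in I) (vol (c k))%:E =
    \esum_(k in I) (vol (lo k))%:E + \esum_(k in I) (vol (hi k))%:E)%E.
  rewrite -esumD//; try by move=> k _; exact: vol_ge0.
  apply: eq_esum => k _; rewrite -EFinD; congr EFin.
  rewrite /vol (bigD1 i)//= [in RHS](bigD1 i)//= [X in _ = _ + X](bigD1 i)//=.
  rewrite !mxE eqxx.
  under [X in _ = _ * X + _]eq_bigr => j /negbTE ji do rewrite !mxE ji.
  under [X in _ = _ + _ * X]eq_bigr => j /negbTE ji do rewrite !mxE ji.
  (* Only the [i]-th side lengths differ, and [max 0 (b - a) = max 0 (min b t - a) + max 0 (b - max
     a t)]. *)
  rewrite -mulrDl; congr (_ * _); rewrite /Num.min /Num.max.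
  by case: ifPn; case: ifPn; case: ifPn; case: ifPn; case: ifPn; lra.
apply: leeD.
  apply: ereal_inf_lbound; exists I, lo; split => // x [/Ac[k Ik xk] xt].
  exists k => // j; have /andP[l u] := xk j; rewrite /= mxE l /=.
  by case: eqP => [->|]//; rewrite le_min xt andbT; have /andP[] := xk i.
apply: ereal_inf_lbound; exists I, hi; split => // x [/Ac[k Ik xk]].
move=> /negP; rewrite -ltNge => xt.
exists k => // j; have /andP[l u] := xk j; rewrite /= mxE u andbT.
by case: eqP => [->|]//; rewrite gt_max xt andbT; have /andP[] := xk i.
Qed.

Lemma measurable_coord i :
  measurable_fun setT (fun x : leb_space R d => (x : 'rV[R]_d) 0 i).
Proof.
apply: (measurability _ (RGenOInfty.measurableE R)) => //.
move=> /= _ [_ [x ->] <-]; rewrite setTI.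
rewrite [X in measurable X](_ : _ =
    ~` ([set y | y 0 i <= x] : set (leb_space R d))).
  by apply: measurableC; exact: measurable_halfspace.
apply/seteqP; split => y /=; rewrite in_itv/= andbT ltNge; first by move/negP.
by move=> /negP.
Qed.

(** An open set is the union of the open boxes with rational corners that it contains, and there are
    only countably many of these. *)
Lemma open_rV_measurable A : open A -> measurable (A : set (leb_space R d)).
Proof.
move=> oA.
pose B (p : 'rV[rat]_d * 'rV[rat]_d) : set (leb_space R d) :=
  [set x | forall i, ratr (p.1 0 i) < (x : 'rV[R]_d) 0 i < ratr (p.2 0 i)].
rewrite (_ : A = \bigcup_(p in [set p | B p `<=` A]) B p); last first.
  apply/seteqP; split; last by move=> x [p /= pA /pA].
  move=> x Ax; have /nbhs_ballP[e /= e0 xeA] := open_nbhs_nbhs (conj oA Ax).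
  have lo i : exists q : rat, x 0 i - e < ratr q < x 0 i.
    have /rat_in_itvoo[q] : x 0 i - e < x 0 i by lra.
    by rewrite in_itv/=; exists q.
  have hi i : exists q : rat, x 0 i < ratr q < x 0 i + e.
    have /rat_in_itvoo[q] : x 0 i < x 0 i + e by lra.
    by rewrite in_itv/=; exists q.
  have {lo}[l /= Hl] := choice lo; have {hi}[u /= Hu] := choice hi.
  exists (\row_i l i, \row_i u i); last first.
    by move=> i /=; rewrite !mxE; move: (Hl i) (Hu i); lra.
  move=> y yB; apply: xeA; split => // k i; rewrite ord1.
  have := yB i; rewrite /= !mxE /ball/= => ?; move: (Hl i) (Hu i).
  by rewrite ltr_distlC; lra.
rewrite bigcup_mkcond.
apply: countable_bigcupT_measurable => [|p]; first exact: countableP.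
case: ifP => _; last exact: measurable0.
rewrite (_ : B p = \bigcap_(i in [set: 'I_d])
   (fun x : leb_space R d => (x : 'rV[R]_d) 0 i) @^-1`
      `]ratr (p.1 0 i), ratr (p.2 0 i)[%classic).
  apply: fin_bigcap_measurable => // i _; rewrite -[X in measurable X]setTI.
  exact: measurable_coord.
apply/seteqP; split => x /=.
  by move=> H i _; rewrite /= in_itv /=; exact: H.
by move=> H i; have := H i I; rewrite /= in_itv.
Qed.

Lemma continuous_rV_measurable (D : set 'rV[R]_d) (f : 'rV[R]_d -> R) :
  measurable (D : set (leb_space R d)) -> continuous f ->
  measurable_fun (D : set (leb_space R d)) f.
Proof.
move=> mD cf; apply: (measurable_funS (E := setT)) => //.
apply: (measurability _ (RGenOpens.measurableE R)) => //.
move=> /= _ [_ [a [b ->] <-]]; rewrite setTI.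
by apply: open_rV_measurable; apply: open_comp => //; exact: interval_open.
Qed.

(** Shifting a cover by [- v] keeps the volumes of its boxes. *)
Lemma le_lebo_translate (v : 'rV[R]_d) A :
  (lebo [set x | A (x + v)%R] <= lebo A)%E.
Proof.
apply: le_ereal_inf_tmp => _ [I [c [Ac ->]]].
pose c' k : 'rV[R]_d * 'rV[R]_d := ((c k).1 - v, (c k).2 - v).
apply: ereal_inf_lbound; exists I, c'; split.
  move=> x /Ac[k Ik xk]; exists k => // i; have := xk i.
  by rewrite /= !mxE; lra.
apply: eq_esum => k _; congr EFin; apply: eq_bigr => i _.
by rewrite /= !mxE; congr Num.max; lra.
Qed.

Lemma lebo_translate (v : 'rV[R]_d) A : lebo [set x | A (x + v)] = lebo A.
Proof.
apply/eqP; rewrite eq_le le_lebo_translate/=.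
have := le_lebo_translate (- v) [set x | A (x + v)].
by congr (_ <= _)%E; congr lebo; apply/funext => x /=; rewrite addrNK.
Qed.

(** Caratheodory's condition involves the outer measure alone, so it is invariant under
    translations: the test set [X] is translated along with [A]. *)
Lemma measurable_translate (v : 'rV[R]_d) :
  measurable_fun setT (fun x : leb_space R d => (x + v : leb_space R d)).
Proof.
move=> _ A; rewrite setTI.
change ((@lebo R d).-caratheodory A ->
  (@lebo R d).-caratheodory [set x : 'rV[R]_d | A (x + v)]) => mA X.
rewrite -(lebo_translate (- v) X) [LHS]mA -(lebo_translate v (_ `&` A)).
rewrite -(lebo_translate v (_ `&` ~` A)).
by congr (_ + _)%E; congr lebo; apply/seteqP; split => x; rewrite /setI/= addrK => -[]; split.
Qed.

Lemma leb_bounded_lty (D : set 'rV[R]_d) (M : R) :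
  (forall x, D x -> forall i, `|x 0 i| <= M) -> (leb D < +oo)%E.
Proof.
(* One box suffices. Its lower corner is [- M - 1] because boxes are open on the left and
   [x_i = - M] has to be covered. *)
move=> DM; pose c : nat -> 'rV[R]_d * 'rV[R]_d :=
  fun=> (const_mx (- M - 1), const_mx M).
apply: (@le_lt_trans _ _ (vol (c 0%N))%:E); last exact: ltry.
apply: ereal_inf_lbound; exists [set 0%N], c; split.
  move=> x /DM xM; exists 0%N => // i; rewrite !mxE.
  by have := xM i; rewrite ler_norml; lra.
by rewrite esum_set1//; exact: vol_ge0.
Qed.

(** The push-forward of [leb] under a translation is [leb] itself, so this is a change of
    variables. *)
Lemma integral_translate (v : 'rV[R]_d) (f : leb_space R d -> \bar R) :
  (@leb R d).-integrable setT f ->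
  (\int[@leb R d]_x f (x + v)%R = \int[@leb R d]_x f x)%E.
Proof.
move=> intf.
pose phi : leb_space R d -> leb_space R d := fun x => (x : 'rV[R]_d) + v.
have mv : measurable_fun setT phi := measurable_translate v.
have H (A : set (leb_space R d)) : measurable A -> A `<=` setT ->
    pushforward (@leb R d) phi A = leb A.
  by move=> _ _; exact: lebo_translate.
have mf := measurable_int _ intf.
have iff : (@leb R d).-integrable setT (f \o phi).
  apply/integrableP; split; first exact: measurableT_comp mf mv.
  have /integrableP[_] := intf.
  rewrite -(eq_measure_integral _ H) ge0_integral_pushforward//.
  exact: measurableT_comp.
have := @integral_pushforward _ _ _ _ _ _ mv (@leb R d) setT f mf.
by rewrite preimage_setT => /(_ iff measurableT) <-; exact: eq_measure_integral.
Qed.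

End LebesgueRd.

(** * Integrability and dominated convergence with a bounded support *)

Section DominatedSupport.
Context {R : realType} {d : nat}.
Variables (B : set 'rV[R]_d) (M C : R).
Hypothesis mB : measurable (B : set (leb_space R d)).
Hypothesis BM : forall x, B x -> forall i, `|x 0 i| <= M.

Let dominant_integrable :
  (@leb R d).-integrable setT (fun x => (C * \1_B x)%:E).
Proof.
under eq_fun do rewrite EFinM.
apply: integrableZl => //.
apply/integrableP; split.
  by apply/measurable_EFinP; exact: measurable_indic.
under eq_integral => x _ do rewrite gee0_abs ?lee_fin//.
by rewrite integral_indic// setIT; exact: (leb_bounded_lty BM).
Qed.

Lemma dominated_integrable_rV (f : leb_space R d -> R) :
  measurable_fun setT f -> (forall x, `|f x| <= C * \1_B x) ->
  (@leb R d).-integrable setT (EFin \o f).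
Proof.
move=> mf fC; apply: le_integrable dominant_integrable => //.
  exact/measurable_EFinP.
by move=> x _; rewrite lee_fin (le_trans (fC x))// ler_norm.
Qed.

Lemma dominated_cvg_rV (fk : nat -> leb_space R d -> R) (f : leb_space R d -> R) :
  (forall k, measurable_fun setT (fk k)) ->
  (forall x, fk k x @[k --> \oo] --> f x) ->
  (forall k x, `|fk k x| <= C * \1_B x) ->
  \int[@leb R d]_x fk k x @[k --> \oo] --> \int[@leb R d]_x f x.
Proof.
move=> mfk cvf fC.
have mf : measurable_fun setT f by apply: measurable_fun_cvg mfk _ => x _.
have [] := @dominated_convergence _ _ _ (@leb R d) setT measurableT
  (fun k x => (fk k x)%:E) (fun x => (f x)%:E) (fun x => (C * \1_B x)%:E).
- by move=> k; exact/measurable_EFinP.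
- exact/measurable_EFinP.
- by apply: aeW => x _; apply: cvg_EFin (cvf x); exact: nearW.
- exact: dominant_integrable.
- by apply: aeW => x k _; rewrite lee_fin.
move=> intf _ cv; apply: fine_cvg => /=; rewrite fineK//.
exact: integrable_fin_num.
Qed.

End DominatedSupport.

(** * Weak derivatives as limits of difference quotients *)

Section TestFunctions.
Context {R : realType} {d : nat}.
Implicit Types (f phi : 'rV[R]_d -> R) (v x : 'rV[R]_d).

Lemma is_derive_line (f : 'rV[R]_d -> R) x v (t : R) :
  derivable f (x + t *: v) v ->
  is_derive t (1 : R) (fun s => f (x + s *: v)) ('D_v f (x + t *: v)).
Proof.
move=> df.
have E : (fun h : R => h^-1 *: ((fun s => f (x + s *: v)) (h *: 1 + t) -
      (fun s => f (x + s *: v)) t)) =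
    (fun h : R => h^-1 *: (f (h *: v + (x + t *: v)) - f (x + t *: v))).
  apply/funext => h /=; rewrite [h *: 1]mulr1 scalerDl.
  by rewrite addrCA.
split; first by rewrite /derivable E.
by rewrite /derive E.
Qed.

Lemma compact_support_bounded (S : set 'rV[R]_d) f :
  compact S -> continuous f -> (forall x, ~ S x -> f x = 0) ->
  exists C : R, forall x, `|f x| <= C.
Proof.
move=> cS cf f0.
have : compact (f @` S) by apply: continuous_compact => //; exact: continuous_subspaceT.
move=> /compact_bounded[C [_ HC]].
exists (Num.max (C + 1) 0) => x.
have [Sx|/f0 ->] := pselect (S x); last by rewrite normr0 le_max lexx orbT.
by rewrite le_max HC ?ltrDl//; exists x.
Qed.

Lemma test_fun_bounds (Om : set 'rV[R]_d) phi (j : 'I_d) : test_fun Om phi ->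
  [/\ continuous phi, continuous (fun u => 'D_(axis j) phi u),
      (forall x, derivable phi x (axis j)),
      (forall x, ~ Om x -> phi x = 0 /\ 'D_(axis j) phi x = 0) &
      exists C : R, forall x, `|phi x| <= C /\ `|'D_(axis j) phi x| <= C].
Proof.
move=> [Ckphi [S [cS SOm phi0]]]; have [dphi cDphi] := Ckphi 1%N.
have cphi := Ckphi 0%N.
(* The complement of the compact set [S] is open and [phi] vanishes on it, so the derivative of
   [phi] vanishes there too. *)
have Dphi0 x : ~ S x -> 'D_(axis j) phi x = 0.
  move=> Sx; have oS : open (~` S).
    by apply: closed_openC; apply: compact_closed cS; exact: norm_hausdorff.
  rewrite (@near_eq_derive _ _ _ phi (cst 0))//; first by rewrite derive_cst.
  have : \forall y \near x, (~` S) y by apply: open_nbhs_nbhs.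
  by apply: filterS => y /phi0.
split => //.
- by move=> x; exact: diff_derivable.
- by move=> x Ox; split; [apply: phi0|apply: Dphi0] => /SOm.
have [C1 H1] := compact_support_bounded cS cphi phi0.
have [C2 H2] := compact_support_bounded cS (cDphi j) Dphi0.
by exists (Num.max C1 C2) => x; rewrite !le_max H1 H2 orbT.
Qed.

Lemma increment_le f v (C : R) :
  (forall x, derivable f x v) -> (forall x, `|'D_v f x| <= C) ->
  forall x (h : R), 0 <= h -> `|f (x + h *: v) - f x| <= C * h.
Proof.
move=> df fC x h h0.
have D s : is_derive s (1 : R) (fun s => f (x + s *: v)) ('D_v f (x + s *: v)).
  exact: is_derive_line.
have [|c _] := @MVT_segment R (fun s => f (x + s *: v)) _ 0 h h0 (fun s _ => D s).
  apply: continuous_subspaceT => s; apply: differentiable_continuous.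
  by apply/derivable1_diffP; exact: ex_derive.
rewrite scale0r addr0 subr0 => ->; rewrite normrM (ger0_norm h0).
exact: ler_wpM2r.
Qed.

End TestFunctions.

Section DifferenceQuotients.
Context {R : realType} {d : nat}.
Implicit Types (f g phi : 'rV[R]_d -> R) (x y : 'rV[R]_d).

(** The Lipschitz constant may depend on the ball: this makes the class stable under products, so
    that it contains the polynomials that occur below and their positive parts. *)
Definition lip_on_bounded f := forall M : R, exists2 L : R, 0 <= L &
  forall x y, `|x| <= M -> `|y| <= M -> `|f x - f y| <= L * `|x - y|.

(** The step [1 / (k + 1)] is nonzero and at most 1, so the shifted point stays in the ball of
    radius [M + 1] when [x] lies in that of radius [M]. *)
Definition quot (j : 'I_d) f (k : nat) x : R :=
  k.+1%:R * (f x - f (x - k.+1%:R^-1 *: axis j)).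

Lemma coord_le_norm x i : `|x 0 i| <= `|x|.
Proof.
rewrite [leRHS]/Num.norm/= mx_normrE; apply/bigmax_geP; right => /=.
by exists (0, i).
Qed.

Lemma norm_axis_le (j : 'I_d) : `|axis j : 'rV[R]_d| <= 1.
Proof.
rewrite [leLHS]/Num.norm/= mx_normrE; apply: bigmax_le => [|[i k] _]; first exact: ler01.
by rewrite !mxE; case: (_ && _); rewrite ?normr1 ?normr0.
Qed.

Lemma lip_on_bounded_continuous f : lip_on_bounded f -> continuous f.
Proof.
move=> lf x; have [L L0 HL] := lf (`|x| + 1).
apply/(@cvgrPdist_lt _ _ _ (nbhs x)) => e e0; near=> y.
have yx : `|x - y| < 1.
  by near: y; apply: (@cvgr_dist_lt _ _ _ _ _ id) => //; exact: cvg_id.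
have yx' : `|x - y| < e / (L + 1).
  near: y; apply: (@cvgr_dist_lt _ _ _ _ _ id); first exact: cvg_id.
  by rewrite divr_gt0// ltr_wpDl.
apply: (@le_lt_trans _ _ (L * `|x - y|)).
  apply: HL; first by rewrite lerDl.
  rewrite -(subrKC x y) (le_trans (ler_normD _ _))// lerD2l distrC.
  exact: ltW.
rewrite ltr_pdivlMr ?ltr_wpDl// in yx'.
by apply: le_lt_trans yx'; rewrite mulrC ler_wpM2l// lerDl.
Unshelve. all: by end_near. Qed.

Lemma lip_on_bounded_bounded f (M : R) : lip_on_bounded f ->
  exists2 C : R, 0 <= C & forall x, `|x| <= M -> `|f x| <= C.
Proof.
(* The values are compared with [f 0]. The radius [|M|] replaces [M] so that the ball contains 0
   even for negative [M]. *)
move=> /(_ `|M|)[L L0 HL]; exists (`|f 0| + L * `|M|).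
  by rewrite addr_ge0// mulr_ge0.
move=> x /le_trans/(_ (ler_norm M)) xM.
rewrite -[f x](subrK (f 0)) addrC (le_trans (ler_normD _ _))// lerD2l.
by rewrite (le_trans (HL _ _ xM _)) ?normr0// subr0; exact: ler_wpM2l.
Qed.

(** Derivability is a limit along the punctured neighbourhoods of 0, and a sequence of nonzero
    numbers tending to 0 follows that filter. *)
Lemma cvg_quot_derivable f x (v : 'rV[R]_d) (u : nat -> R) :
  derivable f x v -> u k @[k --> \oo] --> 0 -> (forall k, u k != 0) ->
  (u k)^-1 * (f (x + u k *: v) - f x) @[k --> \oo] --> 'D_v f x.
Proof.
move=> df u0 un0.
have u0' : u k @[k --> \oo] --> 0^'.
  move=> A /= HA; have : \forall k \near \oo, u k != 0 -> A (u k) := u0 _ HA.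
  by apply: filterS => k; apply; exact: un0.
have := cvg_comp _ _ u0' df; apply: cvg_trans; apply: near_eq_cvg.
by apply: nearW => k /=; rewrite [x + _]addrC.
Qed.

Lemma quot_bound f (M : R) : lip_on_bounded f ->
  exists2 L : R, 0 <= L & forall x j k, `|x| <= M -> `|quot j f k x| <= L.
Proof.
move=> lf; have [L L0 HL] := lf (M + 1); exists L => // x j k xM.
have k0 : 0 < (k.+1%:R : R) by rewrite ltr0n.
have h1 : `|k.+1%:R^-1 *: axis j : 'rV[R]_d| <= k.+1%:R^-1.
  rewrite normrZ ger0_norm ?invr_ge0// ger_pMr ?invr_gt0//.
  exact: norm_axis_le.
have h2 : `|k.+1%:R^-1 *: axis j : 'rV[R]_d| <= 1.
  by rewrite (le_trans h1)// invf_le1// ler1n.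
rewrite /quot normrM (ger0_norm (ltW k0)) mulrC -ler_pdivlMr//.
apply: (le_trans (HL _ _ _ _)).
- by rewrite (le_trans xM)// lerDl.
- by rewrite (le_trans (ler_normB _ _))// lerD.
- by rewrite opprB addrC subrK; apply: ler_wpM2l.
Qed.

Lemma norm_le_measurable (M : R) :
  measurable ([set x | `|x| <= M] : set (leb_space R d)).
Proof.
rewrite -[X in measurable X]setCK; apply/measurableC/open_rV_measurable.
apply: closed_openC.
rewrite -[X in closed X]/(Num.norm @^-1` [set r : R | r <= M]).
by apply: preimage_closed => [x _|]; [exact: norm_continuous|exact: closed_le].
Qed.

Lemma continuous_translate f (v : 'rV[R]_d) :
  continuous f -> continuous (fun x => f (x + v)).
Proof.
move=> cf x.
apply: (@continuous_comp _ _ _ (fun y : 'rV[R]_d => y + v) f) => //.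
  by apply: (@cvgD _ _ _ (nbhs x) _ id (cst v)); [exact: cvg_id|exact: cvg_cst].
exact: cf.
Qed.

Lemma quot_continuous j f k : continuous f -> continuous (quot j f k).
Proof.
move=> cf x.
apply: (@continuousM _ _ (cst k.+1%:R) (fun x => f x - f (x - k.+1%:R^-1 *: axis j))).
  exact: cst_continuous.
apply: (@continuousB _ _ _ f (fun x => f (x - _))); first exact: cf.
exact: continuous_translate.
Qed.

(** Discrete integration by parts: a translation by [e_j / (k + 1)] moves the difference quotient
    from [phi] to [f], with a change of sign and of direction. Both sides then pass to the limit by
    dominated convergence. As [f] is defined on the whole space, the boundary of [Om] causes no
    extra term. *)
Lemma weak_derivative_quot (Om : set 'rV[R]_d) (M : R) f g (j : 'I_d) phi :
  open Om -> (forall x, Om x -> `|x| <= M) ->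
  lip_on_bounded f -> (forall x, Om x -> quot j f k x @[k --> \oo] --> g x) ->
  test_fun Om phi ->
  \int[@leb R d]_(x in Om) (f x * 'D_(axis j) phi x) =
    - \int[@leb R d]_(x in Om) (g x * phi x).
Proof.
move=> oOm OmM lf cvg_g /(test_fun_bounds j)[cphi cDphi dphi phi0 [C HC]].
have mOm := open_rV_measurable oOm.
have cf := lip_on_bounded_continuous lf.
have C0 : 0 <= C by apply: le_trans (normr_ge0 (phi 0)) (HC 0).1.
(* The radius exceeds [M] by 1 so that [B] contains all translates of [Om] by the steps
   [h k *: e]. *)
pose B : set (leb_space R d) := [set x | `|x| <= M + 1].
have mB : measurable B by exact: norm_le_measurable.
have BM x : B x -> forall i, `|x 0 i| <= M + 1.
  by move=> Bx i; exact: le_trans (coord_le_norm _ _) Bx.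
pose h k : R := k.+1%:R^-1.
have h0 k : 0 < h k by rewrite invr_gt0 ltr0n.
pose e : 'rV[R]_d := axis j.
have he k : `|h k *: e| <= 1.
  rewrite normrZ ger0_norm ?(ltW (h0 k))// mulr_ile1 ?(ltW (h0 k))//.
    by rewrite invf_le1 ?ltr0n// ler1n.
  exact: norm_axis_le.
have OmB x v : `|v| <= 1 -> Om (x + v) -> B x.
  move=> v1 /OmM xvM; rewrite /B/= -(addrK v x).
  by rewrite (le_trans (ler_normB _ _))// lerD.
have OmB0 x : Om x -> B x by move=> Ox; apply: (OmB x 0); rewrite ?normr0 ?addr0.
have [Cf Cf0 HCf] := lip_on_bounded_bounded (M + 1) lf.
have [L L0 HL] := quot_bound M lf.
(* [P k] carries the forward quotient of [phi], bounded through the mean value theorem; [Q k]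
   carries the backward quotient of [f], bounded through its Lipschitz constant. *)
pose P k x := f x * (k.+1%:R * (phi (x + h k *: e) - phi x)).
pose Q k x := quot j f k x * phi x.
have PB k x : `|P k x| <= Cf * C * \1_B x.
  have [Bx|nBx] := pselect (B x).
    rewrite indicE mem_set// mulr1 normrM; apply: ler_pM => //; first exact: HCf.
    rewrite normrM (ger0_norm (ler0n _ _)) mulrC -ler_pdivlMr ?ltr0n//.
    apply: (@increment_le _ _ phi e C) => //; last exact: ltW.
    by move=> y; case: (HC y).
  rewrite indicE memNset// mulr0 /P (phi0 x _).1; last by move/OmB0.
  by rewrite (phi0 _ _).1 ?subrr ?mulr0 ?normr0// => /(OmB _ _ (he k)).
have QB k x : `|Q k x| <= L * C * \1_B x.
  have [Ox|nOx] := pselect (Om x).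
    rewrite indicE mem_set; last exact: OmB0.
    by rewrite mulr1 normrM ler_pM// ?(HC _).1// HL// OmM.
  by rewrite /Q (phi0 x nOx).1 mulr0 normr0 !mulr_ge0.
have cP k : continuous (P k).
  move=> x; apply: (@continuousM _ _ f); first exact: cf.
  apply: (@continuousM _ _ (cst _)); first exact: cst_continuous.
  by apply: (@continuousB _ _ _ (fun x => phi (x + _))); [exact: continuous_translate|exact: cphi].
have cQ k : continuous (Q k).
  move=> x; apply: (@continuousM _ _ (quot j f k)); last exact: cphi.
  exact: quot_continuous.
have mP k : measurable_fun (setT : set (leb_space R d)) (P k).
  exact: continuous_rV_measurable.
have mQ k : measurable_fun (setT : set (leb_space R d)) (Q k).
  exact: continuous_rV_measurable.
have limP : \int[@leb R d]_x P k x @[k --> \oo] -->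
    \int[@leb R d]_(x in Om) (f x * 'D_(axis j) phi x).
  (* The derivative of [phi] vanishes off [Om], so the integral over [Om] is one over the whole
     space. *)
  rewrite Rintegral_mkcond; apply: (dominated_cvg_rV mB BM mP _ PB) => x.
  have -> : ((fun x => f x * 'D_(axis j) phi x) \_ Om) x = f x * 'D_(axis j) phi x.
    rewrite patchE; case: ifPn => //; rewrite notin_setE => /phi0[_ ->].
    by rewrite mulr0.
  apply: cvgM; first exact: cvg_cst.
  have := cvg_quot_derivable (dphi x) cvg_harmonic (fun k => lt0r_neq0 (h0 k)).
  by under eq_fun do rewrite invrK.
have limQ : \int[@leb R d]_x Q k x @[k --> \oo] -->
    \int[@leb R d]_(x in Om) (g x * phi x).
  rewrite Rintegral_mkcond; apply: (dominated_cvg_rV mB BM mQ _ QB) => x.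
  rewrite patchE; case: ifPn => Ox.
    by apply: cvgM; [apply: cvg_g; rewrite inE in Ox|exact: cvg_cst].
  rewrite (_ : (fun k => _) = cst 0); first exact: cvg_cst.
  apply/funext => k; rewrite /Q (phi0 x _).1 ?mulr0//.
  by rewrite notin_setE in Ox.
have PQ k : \int[@leb R d]_x P k x = - \int[@leb R d]_x Q k x.
  (* The translate of [tau] by [h k *: e] is [f x * phi (x + h k *: e)]. Hence [P k] and [Q k] are
     [k + 1] times the differences of [f * phi] with the translate of [tau] and with [tau], and
     these two have the same integral. *)
  pose tau x := f (x - h k *: e) * phi x.
  have int_supp u : continuous u -> (forall x, u x != 0 -> B x /\ `|u x| <= Cf * C) ->
      (@leb R d).-integrable setT (EFin \o u).
    move=> cu uB; apply: (dominated_integrable_rV (C := Cf * C) mB BM).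
      exact: continuous_rV_measurable.
    move=> x; have [->|/uB[Bx ux]] := eqVneq (u x) 0.
      by rewrite normr0 !mulr_ge0.
    by rewrite indicE mem_set// mulr1.
  have Onz x : phi x != 0 -> Om x.
    by apply: contra_neqP => /phi0[].
  have it : (@leb R d).-integrable setT (EFin \o tau).
    apply: int_supp => [x|x].
      by apply: (@continuousM _ _ (fun x => f (x - _))); [exact: continuous_translate|exact: cphi].
    rewrite mulf_eq0 negb_or => /andP[_ /Onz Ox]; split; first exact: OmB0.
    rewrite normrM ler_pM//; last by case: (HC x).
    by apply/HCf/(OmB _ (h k *: e)) => //; rewrite subrK.
  have ib : (@leb R d).-integrable setT (EFin \o (fun x => f x * phi x)).
    apply: int_supp => [x|x].
      by apply: continuousM; [exact: cf|exact: cphi].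
    rewrite mulf_eq0 negb_or => /andP[_ /Onz/OmB0 Bx]; split => //.
    by rewrite normrM ler_pM// ?HCf//; case: (HC x).
  have its : (@leb R d).-integrable setT (EFin \o (fun x => tau (x + h k *: e))).
    apply: int_supp => [x|x].
      by apply: (@continuous_translate tau) => {}x; apply: (@continuousM _ _ (fun x => f (x - _)));
        [exact: continuous_translate|exact: cphi].
    rewrite /tau addrK mulf_eq0 negb_or => /andP[_ /Onz/OmB Bx].
    by split; [exact: Bx|rewrite normrM ler_pM// ?HCf//; [exact: Bx|case: (HC (x + h k *: e))]].
  have tE : \int[@leb R d]_x tau (x + h k *: e) = \int[@leb R d]_x tau x.
    by congr fine; exact: (integral_translate (h k *: e) it).
  rewrite (_ : P k = fun x => k.+1%:R * (tau (x + h k *: e) - f x * phi x)); last first.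
    by apply/funext => x; rewrite /P /tau addrK; ring.
  rewrite (_ : Q k = fun x => k.+1%:R * (f x * phi x - tau x)); last first.
    by apply/funext => x; rewrite /Q /quot /tau -/(h k) -/e; ring.
  rewrite RintegralZl//; last exact: (integrableB measurableT its ib).
  rewrite RintegralZl//; last exact: (integrableB measurableT ib it).
  rewrite RintegralB// RintegralB// tE; ring.
apply: (cvg_unique _ limP); first exact: norm_hausdorff.
rewrite (_ : (fun k => \int[@leb R d]_x P k x) = (fun k => - \int[@leb R d]_x Q k x)).
  exact: cvgN.
exact/funext.
Qed.

End DifferenceQuotients.

(** * Locally Lipschitz functions and gluing along a zero set *)

Section Gluing.
Context {R : realType} {d : nat}.
Implicit Types (f g p F q : 'rV[R]_d -> R) (x : 'rV[R]_d).

Lemma lip_on_bounded_cst (c : R) : lip_on_bounded (fun _ : 'rV[R]_d => c).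
Proof. by move=> M; exists 0 => // x y _ _; rewrite subrr normr0 mul0r. Qed.

Lemma lip_on_bounded_coord (i : 'I_d) : lip_on_bounded (fun x : 'rV[R]_d => x 0 i).
Proof.
move=> M; exists 1 => // x y _ _; rewrite mul1r.
by have := coord_le_norm (x - y) i; rewrite !mxE.
Qed.

Lemma lip_on_boundedD f g : lip_on_bounded f -> lip_on_bounded g ->
  lip_on_bounded (fun x => f x + g x).
Proof.
move=> lf lg M; have [L1 L10 H1] := lf M; have [L2 L20 H2] := lg M.
exists (L1 + L2) => [|x y xM yM]; first exact: addr_ge0.
rewrite opprD addrACA mulrDl (le_trans (ler_normD _ _))// lerD//.
  exact: H1.
exact: H2.
Qed.

Lemma lip_on_bounded_sum n (f : 'I_n -> 'rV[R]_d -> R) :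
  (forall i, lip_on_bounded (f i)) -> lip_on_bounded (fun x => \sum_i f i x).
Proof.
elim: n f => [|n IH] f lf.
  by under eq_fun do rewrite big_ord0; exact: lip_on_bounded_cst.
under eq_fun do rewrite big_ord_recr.
by apply: lip_on_boundedD; [apply: IH => i; exact: lf|exact: lf].
Qed.

Lemma lip_on_boundedM f g : lip_on_bounded f -> lip_on_bounded g ->
  lip_on_bounded (fun x => f x * g x).
Proof.
move=> lf lg M; have [L1 L10 H1] := lf M; have [L2 L20 H2] := lg M.
have [C1 C10 B1] := lip_on_bounded_bounded M lf.
have [C2 C20 B2] := lip_on_bounded_bounded M lg.
exists (L1 * C2 + C1 * L2) => [|x y xM yM]; first by rewrite addr_ge0// mulr_ge0.
have -> : f x * g x - f y * g y = (f x - f y) * g x + f y * (g x - g y) by ring.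
rewrite (le_trans (ler_normD _ _))// !normrM mulrDl lerD//.
  by rewrite mulrAC; apply: ler_pM => //; [exact: H1|exact: B2].
by rewrite -mulrA; apply: ler_pM => //; [exact: B1|exact: H2].
Qed.

Lemma lip_on_bounded_max0 f : lip_on_bounded f ->
  lip_on_bounded (fun x => Num.max (f x) 0).
Proof.
move=> lf M; have [L L0 H] := lf M; exists L => // x y xM yM.
apply: le_trans (H x y xM yM); have := ler_norm (f x - f y).
have := ler_norm (f y - f x); rewrite (distrC (f y)) /Num.max.
by case: ifPn; case: ifPn; rewrite -?leNgt => *; rewrite ler_norml; lra.
Qed.

(** The backward quotient is the usual one for the negative increment [- 1 / (k + 1)]. *)
Lemma quot_derivable (j : 'I_d) f x : derivable f x (axis j) ->
  quot j f k x @[k --> \oo] --> 'D_(axis j) f x.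
Proof.
move=> df; have h0 : - @harmonic R k @[k --> \oo] --> 0.
  by rewrite -oppr0; apply: cvgN; exact: cvg_harmonic.
have hn k : - @harmonic R k != 0 by rewrite oppr_eq0 invr_eq0 pnatr_eq0.
have := cvg_quot_derivable df h0 hn; apply: cvg_trans; apply: near_eq_cvg.
by apply: nearW => k /=; rewrite /quot scaleNr invrN invrK; ring.
Qed.

Lemma cvg_backward (j : 'I_d) x :
  x - k.+1%:R^-1 *: axis j @[k --> \oo] --> x.
Proof.
rewrite -[X in _ --> X]subr0 -(scale0r (axis j)).
apply: (@cvgB _ _ _ _ _ (fun=> x) (fun k => k.+1%:R^-1 *: axis j)); first exact: cvg_cst.
apply: (@cvgZr_tmp _ _ _ _ _ (fun k => k.+1%:R^-1)); exact: cvg_harmonic.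
Qed.

(* On [F = 0] only the backward quotient is used, so that the limit exists there too. *)
Lemma quot_glue (j : 'I_d) p F q x :
  derivable p x (axis j) -> derivable F x (axis j) -> derivable q x (axis j) ->
  {for x, continuous F} -> {for x, continuous q} ->
  quot j (fun u => p u + Num.max (F u) 0 * q u) k x @[k --> \oo] -->
  if 0 < F x then 'D_(axis j) (fun u => p u + F u * q u) x
  else if F x < 0 then 'D_(axis j) p x
  else 'D_(axis j) p x - Num.max (- 'D_(axis j) F x) 0 * q x.
Proof.
move=> dp dF dq cF cq.
have cFk := cvg_comp _ _ (@cvg_backward j x) cF.
have cqk := cvg_comp _ _ (@cvg_backward j x) cq.
have [F0|F0|F0] := ltgtP 0 (F x).
- have dpFq : derivable (fun u => p u + F u * q u) x (axis j).
    exact: (derivableD dp (derivableM dF dq)).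
  have := quot_derivable dpFq; apply: cvg_trans; apply: near_eq_cvg.
  have : \forall k \near \oo, 0 < F (x - k.+1%:R^-1 *: axis j).
    exact: (cvgr_gt _ cFk).
  by apply: filterS => k Fk; rewrite /quot !max_l// ltW.
- have := quot_derivable dp; apply: cvg_trans; apply: near_eq_cvg.
  have : \forall k \near \oo, F (x - k.+1%:R^-1 *: axis j) < 0.
    exact: (cvgr_lt _ cFk).
  by apply: filterS => k Fk; rewrite /quot !max_r ?mul0r ?addr0// ltW.
(* As [F x = 0], the number [(k + 1) F (x - e_j / (k + 1))] is minus the backward quotient of [F];
   the positive part commutes with the factor [k + 1 >= 0]. *)
have E k : quot j (fun u => p u + Num.max (F u) 0 * q u) k x =
   quot j p k x - Num.max (- quot j F k x) 0 * q (x - k.+1%:R^-1 *: axis j).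
  have k0 : 0 <= (k.+1%:R : R) by [].
  rewrite /quot -F0 maxxx mul0r addr0 sub0r mulrN opprK.
  have -> : Num.max (k.+1%:R * F (x - k.+1%:R^-1 *: axis j)) 0 =
      k.+1%:R * Num.max (F (x - k.+1%:R^-1 *: axis j)) 0.
    by rewrite maxr_pMr// mulr0.
  ring.
under eq_fun do rewrite E.
apply: cvgB; first exact: quot_derivable.
apply: cvgM => //.
have cmax (r : R) : {for r, continuous (fun s : R => Num.max s 0)}.
  by apply: (@continuous_max R R id (cst 0) r); [exact: cvg_id|exact: cst_continuous].
have cN : - quot j F k x @[k --> \oo] --> - 'D_(axis j) F x.
  by apply: cvgN; exact: quot_derivable.
exact: (cvg_comp _ _ cN (cmax _)).
Qed.

Lemma enorm_le m n (A : 'M[R]_(m, n)) (C : 'I_m -> 'I_n -> R) :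
  (forall i j, `|A i j| <= C i j) ->
  enorm A <= Num.sqrt (\sum_i \sum_j C i j ^+ 2).
Proof.
move=> AC; rewrite ler_wsqrtr//; apply: ler_sum => i _; apply: ler_sum => j _.
by rewrite -real_normK ?num_real// lerXn2r// ?nnegrE// (le_trans _ (AC i j)).
Qed.

(** The quotients are continuous and bounded on [Om] by the Lipschitz constants. Their pointwise
    limit [G] inherits measurability and the bound, and it is the weak gradient by
    [weak_derivative_quot]. *)
Lemma W1oo_quot (Om : set 'rV[R]_d) (M : R) (z : 'rV[R]_d -> 'rV[R]_d)
    (G : 'rV[R]_d -> 'M[R]_d) :
  open Om -> (forall x, Om x -> `|x| <= M) ->
  (forall i, lip_on_bounded (fun x => z x 0 i)) ->
  (forall x, Om x -> forall i j,
     quot j (fun u => z u 0 i) k x @[k --> \oo] --> G x i j) ->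
  W1oo Om z G.
Proof.
move=> oOm OmM lz zG.
have mOm := open_rV_measurable oOm.
have cz i := lip_on_bounded_continuous (lz i).
have [C HC] := @choice _ _ (fun i (C : R) => forall x, `|x| <= M -> `|z x 0 i| <= C)
  (fun i => let: ex_intro2 C _ H := lip_on_bounded_bounded M (lz i) in ex_intro _ C H).
have [L HL] := @choice _ _ (fun i (L : R) => forall x j k, `|x| <= M ->
    `|quot j (fun u => z u 0 i) k x| <= L)
  (fun i => let: ex_intro2 C _ H := quot_bound M (lz i) in ex_intro _ C H).
exists (Num.max (Num.sqrt (\sum_(k < 1) \sum_i C i ^+ 2))
                (Num.sqrt (\sum_i \sum_(j < d) L i ^+ 2))); split.
- by move=> i; exact: continuous_rV_measurable.
- move=> i j; apply: (@measurable_fun_cvg _ (leb_space R d) _ _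
    (quot j (fun u => z u 0 i)) (fun x => G x i j)) => [k|x Ox].
    by apply: continuous_rV_measurable => //; exact: quot_continuous.
  exact: zG.
- apply: aeW => x Ox; rewrite !le_max; split; apply/orP; [left|right].
    by apply: enorm_le => k i; rewrite ord1; apply/HC/OmM.
  apply: enorm_le => i j.
  have : `|quot j (fun u => z u 0 i) k x| @[k --> \oo] --> `|G x i j|.
    by apply: cvg_norm; exact: zG.
  by move=> /cvgr_to_le; apply; apply: nearW => k; exact/HL/OmM.
- move=> phi tphi i j; apply: (weak_derivative_quot oOm OmM (lz i) _ tphi) => x Ox.
  exact: zG.
Qed.

End Gluing.

(** * The sheared laminate *)

Section DotProduct.
Context {R : realType} {d : nat}.
Implicit Types (u v w x y : 'rV[R]_d).

Lemma dotvE u v : dotv u v = (u *m v^T) 0 0.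
Proof. by rewrite mxE; apply: eq_bigr => i _; rewrite mxE. Qed.

Lemma dotvC u v : dotv u v = dotv v u.
Proof. by apply: eq_bigr => i _; rewrite mulrC. Qed.

Lemma dotv_is_linear w : linear (fun u => dotv u w).
Proof. by move=> c u v; rewrite !dotvE mulmxDl -scalemxAl !mxE. Qed.

Lemma dotvDl u v w : dotv (u + v) w = dotv u w + dotv v w.
Proof. by rewrite !dotvE mulmxDl mxE. Qed.

Lemma dotvZl c u w : dotv (c *: u) w = c * dotv u w.
Proof. by rewrite !dotvE -scalemxAl mxE. Qed.

Lemma dotvZr c u w : dotv u (c *: w) = c * dotv u w.
Proof. by rewrite dotvC dotvZl dotvC. Qed.

Lemma dotv_axis j w : dotv (axis j) w = w 0 j.
Proof. by rewrite dotvE -rowE !mxE. Qed.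

Lemma enormE u : enorm u = Num.sqrt (dotv u u).
Proof. by rewrite /enorm big_ord1; congr Num.sqrt; apply: eq_bigr => i _; rewrite expr2. Qed.

(** The matrix determinant lemma: [H] relates two block triangular matrices through the same
    unipotent factor, and the block [1 + v u^T] is a 1 by 1 matrix. *)
Lemma det_add_tens u v : \det (1%:M + tens u v) = 1 + dotv u v.
Proof.
have tE : tens u v = u^T *m v.
  by apply/matrixP => i j; rewrite !mxE big_ord1 !mxE.
have H : block_mx 1%:M 0 v 1%:M *m block_mx 1%:M (- u^T) 0 (1%:M + v *m u^T) =
    block_mx (1%:M + u^T *m v) (- u^T) 0 1%:M *m block_mx 1%:M 0 v 1%:M.
  rewrite !mulmx_block !mul1mx !mulmx1 !mul0mx !mulmx0 !addr0 !add0r.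
  by rewrite mulmxN mulNmx addrK addrC addrK.
have := congr1 determinant H.
rewrite !det_mulmx !det_lblock !det_ublock !det1 !mul1r !mulr1 tE => <-.
by rewrite det_mx11 !mxE dotvC dotvE !mxE.
Qed.

Lemma mul_tens u v x y : tens u v *m tens x y = dotv v x *: tens u y.
Proof.
apply/matrixP => i j; rewrite !mxE mulr_suml; apply: eq_bigr => k _.
by rewrite !mxE; ring.
Qed.

Lemma lip_on_bounded_dotv w : lip_on_bounded (fun x => dotv x w).
Proof.
apply: lip_on_bounded_sum => i; apply: lip_on_boundedM.
  exact: lip_on_bounded_coord.
exact: lip_on_bounded_cst.
Qed.

Lemma differentiable_dotv w x : differentiable (fun u => dotv u w) x.
Proof.
pose f : {linear 'rV[R]_d -> R} := HB.pack (fun u => dotv u w)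
  (GRing.isLinear.Build R _ _ _ _ (dotv_is_linear w)).
apply: (@linear_differentiable _ _ _ f).
exact: (lip_on_bounded_continuous (lip_on_bounded_dotv w)).
Qed.

Lemma is_derive_dotv w x v : is_derive x v (fun u => dotv u w) (dotv v w).
Proof.
have dd := differentiable_dotv w x.
pose f : {linear 'rV[R]_d -> R} := HB.pack (fun u => dotv u w)
  (GRing.isLinear.Build R _ _ _ _ (dotv_is_linear w)).
split; first exact: diff_derivable.
rewrite deriveE// (_ : 'd _ x = f :> (_ -> _))//; apply: (@diff_lin _ _ _ f).
exact: (lip_on_bounded_continuous (lip_on_bounded_dotv w)).
Qed.

End DotProduct.

Section Shear.
Context {R : realType} {d : nat}.
Variables (a n w : 'rV[R]_d).
Implicit Types (x v : 'rV[R]_d).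

(** For a unit vector [n] this is [n . psi x] with [psi x = x + (x . w)^2 n]. *)
Definition level x : R := dotv x n + dotv x w * dotv x w.

Let beta : R := dotv a w.

(** With [t = x . w] and [l = level x], the map [1 + a (x) n] sends the [w]-coordinate [t] of
    [psi x] to [t + beta l], and [l] times this coefficient is [(t + beta l)^2 - t^2]. Pulling out
    the factor [l] shows that [shear] is the identity on the zero set of [level]. *)
Definition shear_coef x : R := 2 * beta * dotv x w + beta ^+ 2 * level x.

Definition shear_dir x : 'rV[R]_d := a - shear_coef x *: n.

(* With [psi x = x + (x . w)^2 n], this is [psi^-1 o (1 + a (x) n) o psi]. *)
Definition shear x : 'rV[R]_d := x + level x *: shear_dir x.

(** The positive part glues [shear] and the identity in a single formula, to which [quot_glue]
    applies coordinate by coordinate. *)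
Definition shear_plus x : 'rV[R]_d := x + Num.max (level x) 0 *: shear_dir x.

Definition dlevel x v : R := dotv v n + 2 * dotv x w * dotv v w.

Definition dcoef x v : R := 2 * beta * dotv v w + beta ^+ 2 * dlevel x v.

Definition dshear x v : 'rV[R]_d :=
  v + dlevel x v *: shear_dir x - (level x * dcoef x v) *: n.

Lemma is_derive_level x v : is_derive x v level (dlevel x v).
Proof.
have D1 := is_derive_dotv n x v; have D2 := is_derive_dotv w x v.
apply: (@is_derive_eq _ _ _ _ _ _ _ _ (is_deriveD D1 (is_deriveM D2 D2))).
by rewrite /dlevel /GRing.scale/=; ring.
Qed.

Lemma is_derive_coef x v : is_derive x v shear_coef (dcoef x v).
Proof.
have D1 := is_derive_level x v; have D2 := is_derive_dotv w x v.
exact: (is_deriveD (is_deriveZ (2 * beta) D2) (is_deriveZ (beta ^+ 2) D1)).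
Qed.

Lemma differentiable_level x : differentiable level x.
Proof.
have D1 := differentiable_dotv n x; have D2 := differentiable_dotv w x.
exact: (differentiableD D1 (differentiableM D2 D2)).
Qed.

Lemma differentiable_coef x : differentiable shear_coef x.
Proof.
have D1 := differentiable_level x; have D2 := differentiable_dotv w x.
exact: (differentiableD (differentiableZ (2 * beta) D2) (differentiableZ (beta ^+ 2) D1)).
Qed.

Lemma shearE x : shear x = x + level x *: a + - (level x * shear_coef x) *: n.
Proof. by rewrite /shear /shear_dir scalerBr scalerA addrA scaleNr. Qed.

Lemma differentiable_shear x : differentiable shear x.
Proof.
rewrite (funext shearE).
have D1 := differentiable_level x; have D2 := differentiable_coef x.
have D3 := differentiableZl a D1.
have D4 := differentiableZl n (differentiableN (differentiableM D1 D2)).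
have D0 : differentiable (id : 'rV[R]_d -> 'rV[R]_d) x by [].
have D5 := differentiableD D0 D3. 
have D6 := differentiableD D5 D4. 
exact: D6.
Qed.

Lemma is_derive_shear_coord x v i :
  is_derive x v (fun u => shear u 0 i) (dshear x v 0 i).
Proof.
rewrite (_ : (fun u => shear u 0 i) = fun u => dotv u (axis i) + a 0 i *: level u +
    (- n 0 i) *: (level u * shear_coef u)); last first.
  apply/funext => u; rewrite shearE !mxE dotvC dotv_axis /GRing.scale/=; ring.
have D1 := is_derive_level x v; have D2 := is_derive_coef x v.
have D0 := is_derive_dotv (axis i) x v.
apply: (@is_derive_eq _ _ _ _ _ _ _ _ (is_deriveD (is_deriveD D0
  (is_deriveZ (a 0 i) D1)) (is_deriveZ (- n 0 i) (is_deriveM D1 D2)))).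
rewrite dotvC dotv_axis !mxE /GRing.scale/=; ring.
Qed.

Lemma derive_shear x v : 'D_v shear x = dshear x v.
Proof.
rewrite derive_mx; last exact: diff_derivable (differentiable_shear x).
apply/rowP => i; rewrite mxE; have D := is_derive_shear_coord x v i.
exact: derive_val.
Qed.

Lemma grad_shearE x i j : grad shear x i j = dshear x (axis j) 0 i.
Proof.
rewrite mxE mxE -derive_shear deriveE//; exact: differentiable_shear.
Qed.

Lemma lip_on_bounded_level : lip_on_bounded level.
Proof.
have L (u : 'rV[R]_d) := lip_on_bounded_dotv u.
exact: (lip_on_boundedD (L n) (lip_on_boundedM (L w) (L w))).
Qed.

Lemma lip_on_bounded_coef : lip_on_bounded shear_coef.
Proof.
have L := lip_on_bounded_level; have C c := @lip_on_bounded_cst R d c.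
exact: (lip_on_boundedD (lip_on_boundedM (C _) (lip_on_bounded_dotv w))
  (lip_on_boundedM (C _) L)).
Qed.

Lemma lip_on_bounded_dlevel v : lip_on_bounded (fun x => dlevel x v).
Proof.
have C c := @lip_on_bounded_cst R d c.
exact: (lip_on_boundedD (C _) (lip_on_boundedM
  (lip_on_boundedM (C _) (lip_on_bounded_dotv w)) (C _))).
Qed.

Lemma lip_on_bounded_dcoef v : lip_on_bounded (fun x => dcoef x v).
Proof.
have C c := @lip_on_bounded_cst R d c.
exact: (lip_on_boundedD (C _) (lip_on_boundedM (C _) (lip_on_bounded_dlevel v))).
Qed.

Lemma dshear_continuous v : continuous (fun x => dshear x v).
Proof.
move=> x.
have cl := @lip_on_bounded_continuous _ _ _ lip_on_bounded_level x.
have cc := @lip_on_bounded_continuous _ _ _ lip_on_bounded_coef x.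
have cdl := @lip_on_bounded_continuous _ _ _ (lip_on_bounded_dlevel v) x.
have cdc := @lip_on_bounded_continuous _ _ _ (lip_on_bounded_dcoef v) x.
have cst1 (u : 'rV[R]_d) : {for x, continuous (fun _ : 'rV[R]_d => u)}.
  exact: cst_continuous.
exact: (continuousB (continuousD (cst1 v) (continuousZ cdl (continuousB (cst1 a)
  (continuousZ cc (cst1 n))))) (continuousZ (continuousM cl cdc) (cst1 n))).
Qed.

Lemma C1_shear (O : set 'rV[R]_d) : C1_on O shear.
Proof.
move=> x _; split; first exact: differentiable_shear.
move=> j; have := @dshear_continuous (axis j) x.
by rewrite -(funext (fun u => derive_shear u (axis j))).
Qed.

Hypotheses (nn : dotv n n = 1) (nw : dotv n w = 0).

(** By the chain rule the gradient is [1 + a (x) n] between the gradients of [psi^-1] and [psi].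
    These are [1] plus a multiple of [n (x) w], hence of determinant 1, as [n . w = 0]. *)
Lemma det_grad_shear x : \det (grad shear x) = \det (1%:M + tens a n).
Proof.
have wn : dotv w n = 0 by rewrite dotvC.
(* [t] is the [w]-coordinate of [x] and [s] that of its image, the point at which [psi^-1] is
   differentiated. *)
pose t := dotv x w; pose s := t + beta * level x.
have -> : grad shear x = (1%:M + tens ((- 2 * s) *: n) w) *m (1%:M + tens a n)
    *m (1%:M + tens ((2 * t) *: n) w).
  apply/matrixP => i j; rewrite grad_shearE.
  rewrite !(mulmxDl, mulmxDr, mul1mx, mulmx1, mul_tens, =^~ scalemxAl).
  rewrite !(dotvZl, dotvZr)nn wn !mxE eqxx /=.
  rewrite /dcoef /dlevel !dotv_axis /s /t /shear_coef -/beta (dotvC w a) -/beta.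
  by ring.
rewrite !det_mulmx !(det_add_tens (_ *: n) w) !dotvZl nw !mulr0 addr0.
by rewrite mul1r mulr1.
Qed.

End Shear.

(** * The interface *)

Section MatrixTopology.
Context {R : realType}.

Lemma continuous_mxP (T : topologicalType) m n (f : T -> 'M[R]_(m, n)) :
  (forall i j, continuous (fun x => f x i j)) -> continuous f.
Proof.
move=> cf x; apply/(@cvgrPdist_lt _ _ _ (nbhs x)) => e e0; near=> y.
rewrite [ltLHS]/Num.norm/= mx_normrE; apply: bigmax_lt => // ij _; rewrite !mxE.
move: ij; near: y; apply: filter_forall => ij.
exact: ((@cvgrPdist_lt _ _ _ (nbhs x) _ _ _).1 (cf ij.1 ij.2 x)).
Unshelve. all: by end_near. Qed.

Lemma mulmxr_continuous m n (A : 'M[R]_(m, n)) :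
  continuous (fun x : 'rV[R]_m => x *m A).
Proof.
apply: continuous_mxP => i j.
rewrite (_ : (fun x => _) = fun x => dotv x (col j A)^T).
  exact: (lip_on_bounded_continuous (lip_on_bounded_dotv _)).
apply/funext => x; rewrite ord1 mxE; apply: eq_bigr => k _.
by rewrite !mxE.
Qed.

Lemma continuous_bigsum (T : topologicalType) (I : Type) (s : seq I)
    (f : I -> T -> R) : (forall i, continuous (f i)) ->
  continuous (fun x => \sum_(i <- s) f i x).
Proof.
move=> cf; elim: s => [|i s IH].
  by under eq_fun do rewrite big_nil; move=> x; exact: cst_continuous.
under eq_fun do rewrite big_cons.
by move=> x; apply: continuousD; [exact: cf|exact: IH].
Qed.

Lemma enorm_continuous m n : continuous (@enorm R m n).
Proof.
move=> A.
apply: (@continuous_comp _ _ _ (fun A : 'M[R]_(m, n) => \sum_i \sum_j A i j ^+ 2)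
  Num.sqrt); last exact: sqrt_continuous.
apply: continuous_bigsum => i; apply: continuous_bigsum => j B.
exact: (continuousM (@coord_continuous R m n i j B) (@coord_continuous R m n i j B)).
Qed.

Lemma norm_le_enorm d (x : 'rV[R]_d) : `|x| <= enorm x.
Proof.
rewrite [leLHS]/Num.norm/= mx_normrE; apply: bigmax_le => [|[i j] _].
  exact: sqrtr_ge0.
rewrite /= ord1 -sqrtr_sqr ler_wsqrtr// big_ord1 (bigD1 j)//= lerDl.
by apply: sumr_ge0 => k _; exact: sqr_ge0.
Qed.

Lemma eball_open m n (A : 'M[R]_(m, n)) r : open (eball A r).
Proof.
rewrite (_ : eball A r = (fun B => enorm (B - A)) @^-1` [set s | s < r])//.
apply: open_comp => [B _|]; last exact: open_lt.
apply: (@continuous_comp _ _ _ (fun B : 'M[R]_(m, n) => B - A)); last exact: enorm_continuous.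
by apply: (@continuousB _ _ _ id (cst A)); [exact: cvg_id|exact: cst_continuous].
Qed.

(** The sup norm is at most the Euclidean one. Halving the radius allows a non-strict inequality,
    which is what closures of balls require. *)
Lemma nbhs_eball d (x : 'rV[R]_d) (B : set 'rV[R]_d) : nbhs x B ->
  exists2 r : R, 0 < r & forall y, enorm (y - x) <= r -> B y.
Proof.
move=> /nbhs_ballP[e /= e0 eB]; exists (e / 2); first by rewrite divr_gt0.
move=> y xy; apply: eB; rewrite -ball_normE /= distrC.
apply: le_lt_trans (norm_le_enorm _) _; lra.
Qed.

Lemma nbhs_line d (x v : 'rV[R]_d) (B : set 'rV[R]_d) : nbhs x B ->
  exists2 t : R, 0 < t & B (x + t *: v).
Proof.
move=> nB; have c : {for 0, continuous (fun t : R => x + t *: v)}.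
  apply: (@continuousD _ _ _ (cst x)); first exact: cst_continuous.
  by apply: (@continuousZr_tmp _ _ _ id); exact: cvg_id.
have : \forall t \near (0 : R), B (x + t *: v) by apply: c; rewrite scale0r addr0.
move=> /nbhs_ballP[e /= e0 eB]; exists (e / 2); first by rewrite divr_gt0.
by apply: eB; rewrite /ball/= sub0r normrN gtr0_norm; lra.
Qed.

End MatrixTopology.

(** * Orthonormal frames with a prescribed last axis *)

Section Frames.
Context {R : realType} {d : nat}.

(* The Householder reflection [H] exchanges the first axis and [n]; its other rows
   are the axes sought. If [n] is the first axis, then [c = 2 / 0 = 0] and [H = 1]. *)
Lemma cartesian_axes_exist (n : 'rV[R]_d.+1) : dotv n n = 1 ->
  exists e : 'M[R]_(d, d.+1), @cartesian_axes R d.+1 e n.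
Proof.
move=> nn; pose o : 'rV[R]_d.+1 := axis 0; pose u := n - o.
pose c := 2 / dotv u u; pose H : 'M[R]_d.+1 := 1%:M - c *: tens u u.
have HT : H^T = H.
  by apply/matrixP => i j; rewrite !mxE eq_sym; ring.
have uu : dotv u u = 2 - 2 * n 0 0.
  have B x : dotv u x = dotv n x - dotv o x.
    by rewrite /u dotvDl -scaleN1r dotvZl mulN1r.
  by rewrite B (dotvC n) (dotvC o) !B nn (dotvC n) !dotv_axis !mxE !eqxx /=; ring.
have u0 : dotv u u = 0 -> u = 0.
  move=> /eqP; rewrite psumr_eq0 => [/allP uz|i _]; last by rewrite -expr2 sqr_ge0.
  apply/rowP => i; have := uz i (mem_index_enum i).
  by rewrite /= mulf_eq0 orbb => /eqP ->; rewrite [RHS]mxE.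
have HH : H *m H = 1%:M.
  have cc : c * (c * dotv u u) = 2 * c.
    have [uu0|uu0] := eqVneq (dotv u u) 0; last by rewrite /c; field.
    by rewrite /c uu0 invr0; ring.
  rewrite /H mulmxBl !mulmxBr !mul1mx mulmx1 -scalemxAl -scalemxAr mul_tens.
  rewrite !scalerA -[c * c * _]mulrA cc; apply/matrixP => i j; rewrite !mxE; ring.
have oH : o *m H = n.
  have ou : o *m tens u u = (n 0 0 - 1) *: u.
    rewrite -rowE; apply/rowP => i; rewrite !mxE eqxx /=; ring.
  rewrite mulmxBr mulmx1 -scalemxAr ou scalerA.
  have [uu0|uu0] := eqVneq (dotv u u) 0.
    by rewrite (u0 uu0) scaler0 subr0; apply/esym/eqP; rewrite -subr_eq0; apply/eqP/u0.
  have -> : c * (n 0 0 - 1) = -1.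
    have -> : n 0 0 - 1 = - dotv u u / 2 by rewrite uu; field.
    by rewrite /c; field.
  by rewrite scaleN1r opprK /u addrC subrK.
(* A symmetric involution is orthogonal, so the rows of [H] are orthonormal. Row 0 is [n], and the
   others form [e]. *)
have HHT i j : \sum_k H i k * H j k = (i == j)%:R.
  transitivity ((H *m H^T) i j); last by rewrite HT HH mxE.
  by rewrite [RHS]mxE; apply: eq_bigr => k _; rewrite [H^T k j]mxE.
exists (row' 0 H); split => //.
- apply/matrixP => i j; rewrite mxE [RHS]mxE -(inj_eq (@lift_inj _ ord0)) -HHT.
  by apply: eq_bigr => k _; rewrite [X in X * _]mxE [X in _ * X]mxE [X in _ * X]mxE.
- apply/matrixP => i j; rewrite ord1 mxE [RHS]mxE.
  transitivity (\sum_k H (lift 0 i) k * H 0 k); last by rewrite HHT.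
  apply: eq_bigr => k _; rewrite [X in X * _]mxE [X in _ * X]mxE; congr (_ * _).
  by rewrite -oH -rowE mxE.
Qed.

(** The square matrix [C] with rows [n] and [e] satisfies [C C^T = 1], hence [C^T C = 1], which is
    the decomposition of the identity along the frame. *)
Lemma cartesian_decomp (e : 'M[R]_(d, d.+1)) (n x : 'rV[R]_d.+1) :
  @cartesian_axes R d.+1 e n -> x = (x *m e^T) *m e + dotv x n *: n.
Proof.
move=> [ee en nn]; pose C : 'M[R]_(1 + d, d.+1) := col_mx n e.
have ne : n *m e^T = 0 by apply/trmx_inj; rewrite trmx_mul trmxK en trmx0.
have nnT : n *m n^T = 1%:M.
  by apply/matrixP => i j; rewrite !ord1 -dotvE nn mxE.
have CC : C *m C^T = 1%:M.
  by rewrite /C tr_col_mx mul_col_row nnT ne en ee -scalar_mx_block.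
have E : n^T *m n + e^T *m e = 1%:M.
  by rewrite -mul_row_col -tr_col_mx; exact: (@mulmx1C _ d.+1 C C^T CC).
rewrite -[LHS]mulmx1 -E mulmxDr !mulmxA addrC; congr (_ + _).
by rewrite (mx11_scalar (x *m n^T)) -dotvE mul_scalar_mx.
Qed.

End Frames.

(** * The zero set of the level function as a non-planar surface *)

Section LevelSet.
Context {R : realType} {d' : nat}.
(** In this form the dimension provides [e] with a row 0, the unit vector [w] orthogonal to [n]. *)
Local Notation d := d'.+2.
Variables (n : 'rV[R]_d) (e : 'M[R]_(d.-1, d)) (r : R).
Hypotheses (axes_e : cartesian_axes e n) (r_gt0 : 0 < r).

Local Notation w := (row 0 e).
Local Notation F := (level n w).
Local Notation Om := (eball (0 : 'rV[R]_d) r).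
Local Notation Gam := [set x : 'rV[R]_d | Om x /\ F x = 0].

Let nn : dotv n n = 1. Proof. by case: axes_e. Qed.

Lemma dotv_frame0 x : dotv x w = (x *m e^T) 0 0.
Proof. by rewrite mxE; apply: eq_bigr => i _; rewrite !mxE. Qed.

Lemma dotv_normal_frame0 : dotv n w = 0.
Proof.
case: axes_e => _ en _; rewrite dotv_frame0 (_ : n *m e^T = 0) ?mxE//.
by apply/trmx_inj; rewrite trmx_mul trmxK en trmx0.
Qed.

Let nw := dotv_normal_frame0.

Let ww : dotv w w = 1.
Proof.
case: axes_e => ee _ _; rewrite dotv_frame0 -row_mul ee.
by rewrite !mxE eqxx.
Qed.

(** Moving along [n] does not change [x . w]. This makes the zero set a graph over the hyperplane
    orthogonal to [n], with both sides reached along [n]. *)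
Lemma levelD x (v : R) : F (x + v *: n) = F x + v.
Proof. by rewrite /level !dotvDl !dotvZl nn nw; ring. Qed.

Let cF : continuous F := lip_on_bounded_continuous (lip_on_bounded_level n w).

Let Om_open : open Om := @eball_open _ _ _ _ _.

Lemma side_open (A : set R) : open A -> open [set x | Om x /\ A (F x)].
Proof.
by move=> oA; apply: openI => //; apply: open_comp => // x _; exact: cF.
Qed.

(** The sign selects the side. From a point of the interface, a short step along [n] or [- n] enters
    the open set [A], which does not contain the point. Conversely, a point of the closure has
    signed level at least 0, and at most 0 if it is not in [A]. *)
Lemma frontier_side (s : bool) :
  Gam = Om `&` frontier [set x | Om x /\ 0 < (-1) ^+ s * F x].
Proof.
set A := [set x | _ /\ 0 < _].
have oA : open A.
  rewrite (_ : A = [set x | Om x /\ [set v : R | 0 < (-1) ^+ s * v] (F x)])//.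
  apply: side_open.
  apply: (@open_comp _ _ (fun v : R => (-1) ^+ s * v) [set v : R | 0 < v]); last exact: open_gt.
  by move=> x _; exact: mulrl_continuous.
apply/seteqP; split => x.
  move=> [Ox Fx]; split => //; split; last first.
    by rewrite (interior_id A).1//= => -[_]; rewrite Fx mulr0 ltxx.
  move=> B nB.
  have /(nbhs_line ((-1) ^+ s *: n))[t t0 [Ot Bt]] : nbhs x (Om `&` B).
    by apply: filterI => //; apply: open_nbhs_nbhs.
  exists (x + t *: ((-1) ^+ s *: n)); split => //; split => //.
  by rewrite scalerA levelD Fx add0r mulrCA -expr2 sqrr_sign mulr1.
move=> [Ox [clx]]; rewrite (interior_id A).1// => nAx; split => //.
have Fge : 0 <= (-1) ^+ s * F x.
  have cl : closed [set x | 0 <= (-1) ^+ s * F x].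
    apply: (@preimage_closed _ _ (fun x => (-1) ^+ s * F x) [set v : R | 0 <= v]).
      by move=> y _; apply: (@continuousM _ _ (cst _) F y); [exact: cst_continuous|exact: cF].
    exact: closed_ge.
  apply: cl; apply: closure_subset clx => y [_ /ltW]//.
have : ~~ (0 < (-1) ^+ s * F x) by apply/negP => ?; exact: nAx.
rewrite -leNgt => Fle.
have /eqP : (-1) ^+ s * F x = 0 by apply/eqP; rewrite eq_le Fle Fge.
by rewrite mulf_eq0 signr_eq0 => /eqP.
Qed.

(** In the coordinates [u = x *m e^T], of which the first is [x . w], the equation [level = 0] is
    solved by [x . n = - u_0^2]. *)
Let g (u : 'rV[R]_d.-1) : R := - (u 0 0 * u 0 0).

Let graph (u : 'rV[R]_d.-1) : 'rV[R]_d := u *m e + g u *: n.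

Let lip_g : lip_on_bounded g.
Proof.
have L := @lip_on_bounded_coord R d.-1 0.
apply: (@eq_ind _ (fun u : 'rV[R]_d.-1 => -1 * (u 0 0 * u 0 0)) (@lip_on_bounded R d.-1)).
  exact: (lip_on_boundedM (@lip_on_bounded_cst R d.-1 (-1)) (lip_on_boundedM L L)).
by apply/funext => u; rewrite mulN1r.
Qed.

Let graph_continuous : continuous graph.
Proof.
have ce : continuous (fun u : 'rV[R]_d.-1 => u *m e) := @mulmxr_continuous _ _ _ e.
have cg : continuous g := @lip_on_bounded_continuous _ _ _ lip_g.
have cn u : {for u, continuous (fun u : 'rV[R]_d.-1 => g u *: n)}.
  exact: (continuousZr_tmp (cg u)).
move=> u; exact: (continuousD (ce u) (cn u)).
Qed.

Let graph_frame u : graph u *m e^T = u.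
Proof.
case: axes_e => ee en _.
rewrite /graph mulmxDl -mulmxA ee mulmx1 -scalemxAl (_ : n *m e^T = 0) ?scaler0 ?addr0//.
by apply/trmx_inj; rewrite trmx_mul trmxK en trmx0.
Qed.

Let F_graph u : F (graph u) = 0.
Proof.
rewrite levelD /level dotvE -mulmxA; case: axes_e => _ -> _.
rewrite mulmx0 mxE add0r.
have := dotv_frame0 (graph u); rewrite graph_frame /graph dotvDl dotvZl nw mulr0 addr0.
by move=> ->; rewrite /g subrr.
Qed.

Let graphK x : F x = 0 -> graph (x *m e^T) = x.
Proof.
rewrite /level dotv_frame0 => /eqP; rewrite addr_eq0 => /eqP Fx.
by rewrite /graph /g -Fx -(cartesian_decomp _ axes_e).
Qed.

Lemma closure_ball_le x : closure Om x -> enorm x <= r.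
Proof.
have cl : closed [set x : 'rV[R]_d | enorm x <= r].
  apply: (@preimage_closed _ _ (@enorm R 1 d) [set v : R | v <= r]).
    by move=> y _; exact: enorm_continuous.
  exact: closed_le.
by move=> clx; apply: cl; apply: closure_subset clx => y; rewrite /eball/= subr0 => /ltW.
Qed.

(** The projection [x *m e^T] is a global chart of the zero set, with inverse [graph]; only the
    restriction to [Om] forces local choices of radii. *)
Lemma C1_surface_level : C1_surface Gam.
Proof.
split; first split.
- apply: bounded_closed_compact; last exact: closed_closure.
  exists r; split; first exact: num_real.
  move=> M rM x clx; apply: le_trans (norm_le_enorm x) _; apply: le_trans (ltW rM).
  by apply: closure_ball_le; apply: closure_subset clx => y [].
- move=> xi [Oxi Fxi]; pose c := xi *m e^T.
  (* The ball around [c] is so small that [graph] maps it into [Om]. *)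
  have nc : nbhs c (graph @^-1` Om).
    apply: graph_continuous; rewrite /c graphK//.
    by apply: open_nbhs_nbhs.
  have [rho rho0 Hrho] := nbhs_eball nc.
  pose V : set 'rV[R]_d := Om `&` [set x | eball c rho (x *m e^T)].
  exists V, c, rho; split => //.
  + apply: openI => //.
    apply: (@open_comp _ _ (fun x : 'rV[R]_d => x *m e^T)); last exact: eball_open.
    by move=> x _; exact: mulmxr_continuous.
  + by split => //=; rewrite /eball/= subrr /enorm big1 ?sqrtr0// => i _;
      rewrite big1// => j _; rewrite mxE expr0n.
  exists (fun x => x *m e^T), graph; split.
  + by apply: continuous_subspaceT => x; exact: mulmxr_continuous.
  + exact: continuous_subspaceT.
  + by move=> x [[_ Fx] [_ ?]]; split => //; exact: graphK.
  + move=> u uc; split; last exact: graph_frame.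
    have Ou : Om (graph u) by apply: Hrho; exact: ltW.
    by split; [split => //; exact: F_graph|split => //=; rewrite graph_frame].
- move=> xi [Oxi Fxi].
  have [r1 r10 Hr1] : exists2 s : R, 0 < s & forall y, enorm (y - xi) <= s -> Om y.
    by apply: nbhs_eball; exact: open_nbhs_nbhs.
  exists r1, 0, e, n, g; split => //.
    (* [level] with zero normal is the square of the first coordinate, so its differentiability
       lemmas apply to [g]. *)
    have gE : g = fun u : 'rV[R]_d.-1 => - level 0 (axis 0) u.
      apply/funext => u; rewrite /g /level dotvC dotvE mul0mx [X in - (X + _)]mxE add0r.
      by rewrite dotvC dotv_axis.
    have dl u := @differentiable_level R d.-1 0 (axis 0) u.
    move=> u _; rewrite gE; split; first exact: differentiableN (dl u).
    move=> j.
    have -> : (fun v => 'D_(axis j) (fun u : 'rV[R]_d.-1 => - level 0 (axis 0) u) v) =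
        fun v => - dlevel 0 (axis 0) v (axis j).
      apply/funext => v; have D := is_derive_level 0 (axis 0) v (axis j).
      have := @derive_val _ _ _ _ _ _ _ (is_deriveN D); exact.
    apply: continuousN.
    exact: (@lip_on_bounded_continuous _ _ _ (lip_on_bounded_dlevel 0 (axis 0) (axis j)) u).
  apply/seteqP; split => x /=.
    move=> [[Ox Fx] xr]; split => //; rewrite subr0.
    by move/eqP: Fx; rewrite /level dotv_frame0 addr_eq0 => /eqP.
  move=> [xr]; rewrite subr0 => E; split => //; split; first by apply: Hr1; exact: ltW.
  by rewrite /level dotv_frame0 E /g addNr.
Qed.

(** The vector on the left is the gradient of [level] at [xi], and [level] vanishes along any curve
    in the surface: the chain rule at time 0 gives the claim. *)
Let dlevel_tangent xi tau : tangent Gam xi tau -> dotv (n + (2 * dotv xi w) *: w) tau = 0.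
Proof.
move=> [gam [gam0 gamG dgam]].
have dg : differentiable gam 0 by apply/derivable1_diffP; exact: ex_derive.
have dF : differentiable F (gam 0) by exact: differentiable_level.
have dFg : differentiable (F \o gam) 0 by exact: differentiable_comp.
have : 'D_1 (F \o gam) 0 = 0.
  rewrite (@near_eq_derive _ _ _ _ (cst 0)) ?derive_cst//.
  by move: gamG; apply: filterS => t [].
rewrite deriveE// diff_comp//= -!deriveE// gam0.
have -> : 'D_1 gam 0 = tau by exact: derive_val.
have D := is_derive_level n w xi tau.
rewrite (@derive_val _ _ _ _ _ _ _ D) => <-.
by rewrite /dlevel dotvDl dotvZl !(dotvC _ tau).
Qed.

(** The normals at 0 and at a point with [x . w] nonzero differ, even up to sign: the [w]-component
    is zero for the first and nonzero for the second. *)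
Lemma non_planar_level : non_planar Gam.
Proof.
(* The gradient is normalised: [|n + 2 t w|^2 = 1 + 4 t^2]. *)
pose N (t : R) : 'rV[R]_d := (Num.sqrt (1 + 4 * t ^+ 2))^-1 *: (n + (2 * t) *: w).
have wn : dotv w n = 0 by rewrite dotvC.
have pos (t : R) : 0 < Num.sqrt (1 + 4 * t ^+ 2) by rewrite sqrtr_gt0; nra.
have Nnormal xi : Gam xi -> unit_normal Gam xi (N (dotv xi w)).
  move=> Gxi; split; last first.
    by move=> tau /dlevel_tangent E; rewrite /N dotvZl E mulr0.
  rewrite enormE /N !(dotvZl, dotvZr) !dotvDl !(dotvC _ (n + _)) !dotvDl.
  rewrite !(dotvZl, dotvZr) nn nw ww wn.
  have E : Num.sqrt (1 + 4 * dotv xi w ^+ 2) ^+ 2 = 1 + 4 * dotv xi w ^+ 2.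
    by rewrite sqr_sqrtr//; nra.
  rewrite (_ : _ * _ = 1) ?sqrtr1//.
  set S := Num.sqrt _ in E *.
  have S0 : S != 0 by rewrite gt_eqF// pos.
  suff H X : X = S ^+ 2 -> S^-1 * (S^-1 * X) = 1 by apply: H; rewrite E; ring.
  by move=> ->; field.
have NwE t : dotv (N t) w = (Num.sqrt (1 + 4 * t ^+ 2))^-1 * (2 * t).
  by rewrite /N dotvZl dotvDl dotvZl nw ww add0r mulr1.
(* With [s <= 1] and [s <= r / 2], the point [xi] has [|xi|^2 = s^2 + s^4 <= r^2 / 2], so it lies in
   the ball; its normal component [- s^2] puts it on the surface. *)
pose s := Num.min 1 (r / 2).
have s0 : 0 < s by rewrite lt_min ltr01 divr_gt0.
pose xi := s *: w + (- s ^+ 2) *: n.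
have xiw : dotv xi w = s by rewrite dotvDl !dotvZl nw ww; ring.
have Gxi : Gam xi.
  split; last by rewrite /level xiw dotvDl !dotvZl nn wn; ring.
  rewrite /eball/= subr0 enormE.
  have -> : dotv xi xi = s ^+ 2 + s ^+ 4.
    rewrite [LHS]dotvDl !dotvZl !(dotvC _ xi) !dotvDl !dotvZl nn nw ww wn; ring.
  have s1 : s <= 1 by rewrite ge_min lexx.
  have sr : s <= r / 2 by rewrite ge_min lexx orbT.
  rewrite -(ger0_norm (ltW r_gt0)) -sqrtr_sqr ltr_sqrt; last by rewrite exprn_gt0.
  have : s ^+ 4 <= s ^+ 2 by rewrite ler_wiXn2l// ltW.
  have : s ^+ 2 <= (r / 2) ^+ 2 by rewrite lerXn2r// ?nnegrE ltW// divr_gt0.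
  have : 0 < r ^+ 2 by rewrite exprn_gt0.
  lra.
have dotv0 : dotv 0 w = 0 by rewrite dotvE mul0mx mxE.
have G0 : Gam 0.
  rewrite /eball/= subr0 /level !dotvE !mul0mx !mxE mulr0 addr0.
  by split => //; rewrite enormE dotvE mul0mx mxE sqrtr0.
exists 0, xi, (N (dotv 0 w)), (N (dotv xi w)); split => //.
- exact: Nnormal.
- exact: Nnormal.
- move=> /(congr1 (fun v => dotv v w)) /=; rewrite !NwE xiw dotv0 mulr0 mulr0.
  by move/esym/eqP; rewrite mulf_eq0 invr_eq0 (gt_eqF (pos s)) mulf_eq0 pnatr_eq0 (gt_eqF s0).
- move=> /(congr1 (fun v => dotv v w)) /=.
  rewrite [in X in X -> _]NwE -[- N _]scaleN1r (dotvZl (-1)) NwE xiw dotv0.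
  rewrite mulr0 mulr0 mulN1r.
  move/esym/eqP; rewrite oppr_eq0 mulf_eq0 invr_eq0 (gt_eqF (pos s)).
  by rewrite mulf_eq0 pnatr_eq0 (gt_eqF s0).
Qed.

End LevelSet.

(** * Gradients of the shear and of the glued deformation *)

Section ShearMap.
Context {R : realType} {d : nat}.
Variables (a n w : 'rV[R]_d).
Implicit Types x : 'rV[R]_d.

Lemma grad_shear_continuous : continuous (grad (shear a n w)).
Proof.
apply: continuous_mxP => i j.
have cd := @dshear_continuous _ _ a n w (axis j).
rewrite (_ : (fun x => _) = fun x => dshear a n w x (axis j) 0 i); last first.
  by apply/funext => x; rewrite grad_shearE.
move=> x; apply: (@continuous_comp _ _ _ (fun x => dshear a n w x (axis j)) (fun v => v 0 i)).
  exact: cd.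
exact: coord_continuous.
Qed.

Lemma grad_shear0 : grad (shear a n w) 0 = 1%:M + tens a n.
Proof.
apply/matrixP => i j; rewrite grad_shearE !mxE eqxx /=.
have d0 (u : 'rV[R]_d) : dotv 0 u = 0 by rewrite dotvE mul0mx mxE.
by rewrite /dlevel /shear_coef /level !d0 !dotv_axis; ring.
Qed.

(** Continuity of the gradient at 0, where it equals [1 + a (x) n]. The bound includes
    [enorm x = r], hence the closure of the ball. *)
Lemma grad_shear_near0 (eps : R) : 0 < eps ->
  exists2 r : R, 0 < r & forall x, enorm x <= r ->
    eball (1%:M + tens a n) eps (grad (shear a n w) x).
Proof.
move=> e0; have : nbhs (0 : 'rV[R]_d) (grad (shear a n w) @^-1` eball (1%:M + tens a n) eps).
  apply: grad_shear_continuous; apply: open_nbhs_nbhs; split; first exact: eball_open.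
  rewrite grad_shear0 /eball/= subrr /enorm big1 ?sqrtr0// => i _.
  by rewrite big1// => j _; rewrite mxE expr0n.
by move=> /nbhs_eball[r r0 Hr]; exists r => // x xr; apply: Hr; rewrite subr0.
Qed.

(* On the interface this is the derivative along backward increments. *)
Definition shear_plus_grad x : 'M[R]_d := \matrix_(i, j)
  if 0 < level n w x then grad (shear a n w) x i j
  else if level n w x < 0 then (i == j)%:R
  else (i == j)%:R -
    Num.max (- 'D_(axis j) (level n w) x) 0 * shear_dir a n w x 0 i.

(** Each coordinate has the form [p + max F 0 * q] with [p] a coordinate, [F = level] and [q] a
    component of [shear_dir], so [quot_glue] yields the limits that [W1oo_quot] requires. *)
Lemma W1oo_shear_plus (Om : set 'rV[R]_d) (M : R) :
  open Om -> (forall x, Om x -> `|x| <= M) ->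
  W1oo Om (shear_plus a n w) shear_plus_grad.
Proof.
move=> oOm OmM.
have zE i : (fun x => shear_plus a n w x 0 i) =
    fun x => x 0 i + Num.max (level n w x) 0 * (shear_dir a n w x 0 i).
  by apply/funext => x; rewrite !mxE.
have qE i : (fun x => shear_dir a n w x 0 i) =
    fun x => a 0 i + shear_coef a n w x * (- n 0 i).
  by apply/funext => x; rewrite !mxE mulrN.
have lq i : lip_on_bounded (fun x => shear_dir a n w x 0 i).
  rewrite qE; apply: lip_on_boundedD; first exact: lip_on_bounded_cst.
  apply: lip_on_boundedM; last exact: lip_on_bounded_cst.
  exact: lip_on_bounded_coef.
apply: (W1oo_quot oOm OmM) => [i|x Ox i j].
  rewrite zE; apply: lip_on_boundedD; first exact: lip_on_bounded_coord.
  apply: lip_on_boundedM => //; apply: lip_on_bounded_max0.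
  exact: lip_on_bounded_level.
rewrite zE.
have D0 : is_derive x (axis j) (fun u : 'rV[R]_d => u 0 i) (i == j)%:R.
  have := is_derive_dotv (axis i) x (axis j).
  rewrite dotv_axis !mxE eqxx /= eq_sym; congr is_derive.
  by apply/funext => u; rewrite dotvC dotv_axis.
have D1 := is_derive_level n w x (axis j).
have D2 := is_derive_coef a n w x (axis j).
have dq : derivable (fun x => shear_dir a n w x 0 i) x (axis j).
  rewrite qE; apply: (@ex_derive _ _ _ _ _ _ _ (is_deriveD
   (is_derive_cst (a 0 i) x (axis j)) (is_deriveM D2 (is_derive_cst (- n 0 i) x (axis j))))).
have cl := @lip_on_bounded_continuous _ _ _ (lip_on_bounded_level n w) x.
have cq := @lip_on_bounded_continuous _ _ _ (lq i) x.
have := quot_glue (@ex_derive _ _ _ _ _ _ _ D0) (@ex_derive _ _ _ _ _ _ _ D1) dq cl cq.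
rewrite (@derive_val _ _ _ _ _ _ _ D0) [shear_plus_grad x i j]mxE; congr (_ --> _).
case: ifP => // _; rewrite grad_shearE.
rewrite -(@derive_val _ _ _ _ _ _ _ (is_derive_shear_coord a n w x (axis j) i)).
by congr ('D_ _ _ _); apply/funext => u; rewrite !mxE.
Qed.

End ShearMap.

Theorem lemma3p3 (R : realType) (d : nat) (d_ge2 : (2 <= d)%N)
    (Delta : R) (Delta_gt0 : 0 < Delta)
    (O : set 'rV[R]_d) (domO : bounded_domain O)
    (K : set 'M[R]_d) (K_det : K `<=` detset Delta) (K_compact : compact K)
    (rint_K : rint (detset Delta) (qc_hull O K) !=set0)
    (eps : R) (eps_gt0 : 0 < eps) (a n : 'rV[R]_d)
    (a_neq0 : a != 0) (n_neq0 : n != 0) (n_unit : enorm n = 1)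
    (an_det : detset Delta (1%:M + tens a n))
    (ball_K : eball (1%:M + tens a n) eps `&` detset Delta `<=` qc_hull O K) :
  exists (r : R) (Omp Omm Gam : set 'rV[R]_d),
    let Om := eball (0 : 'rV[R]_d) r in
    [/\ 0 < r,
        open Omp /\ open Omm,
        Omp `&` Omm = set0,
        C1_surface Gam /\ non_planar Gam
      & [/\ Om = Omp `|` Gam `|` Omm,
            Gam = Om `&` frontier Omp
          & Gam = Om `&` frontier Omm]] /\
    exists (z : 'rV[R]_d -> 'rV[R]_d) (Dz : 'rV[R]_d -> 'M[R]_d)
           (y : 'rV[R]_d -> 'rV[R]_d),
      [/\ W1oo Om z Dz,
          C1_closure Omp y,
          forall x, closure Omp x -> qc_hull O K (closure_grad Omp y x),
          forall x, Omp x -> Dz x = grad y x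
        & forall x, Omm x -> Dz x = 1%:M].
Proof.
case: d d_ge2 O domO K K_det K_compact rint_K a n a_neq0 n_neq0 n_unit an_det ball_K
  => [//|[//|d]] _ O _ K _ _ _ a n _ _ n_unit an_det ball_K.
have nn : dotv n n = 1.
  move: n_unit; rewrite enormE => /(congr1 (fun s => s ^+ 2)).
  by rewrite expr1n sqr_sqrtr// sumr_ge0// => i _; rewrite -expr2 sqr_ge0.
have [e axes_e] := cartesian_axes_exist nn.
pose w := row 0 e; have nw : dotv n w = 0 := dotv_normal_frame0 axes_e.
have [r r0 Hr] := grad_shear_near0 a n w eps_gt0.
pose F := level n w; pose y := shear a n w.
pose Om : set 'rV[R]_d.+2 := eball 0 r.
(* The two signs in [frontier_side] give the two sides of the interface. *)
have fp : [set x | Om x /\ F x = 0] = Om `&` frontier [set x | Om x /\ 0 < F x].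
  have := frontier_side r axes_e false; rewrite expr0.
  by under [X in _ = _ `&` frontier X]eq_set do rewrite mul1r.
have fm : [set x | Om x /\ F x = 0] = Om `&` frontier [set x | Om x /\ F x < 0].
  have := frontier_side r axes_e true; rewrite expr1.
  by under [X in _ = _ `&` frontier X]eq_set do rewrite mulN1r oppr_gt0.
exists r, [set x | Om x /\ 0 < F x], [set x | Om x /\ F x < 0], [set x | Om x /\ F x = 0].
move=> ?; split.
  split => //.
  - split; first exact: (side_open (@open_gt _ 0)).
    exact: (side_open (@open_lt _ 0)).
  - by apply/seteqP; split => // x [[_ F0] [_ /(lt_trans F0)]]; rewrite ltxx.
  - split; first exact: C1_surface_level.
    exact: non_planar_level.
  split => //; apply/seteqP; split => x; last by move=> [[[]|[]]|[]].
  move=> Ox; have [F0|F0|F0] := ltgtP (F x) 0; [right|left; left|left; right] => //.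
have OmE x : Om x -> enorm x <= r by rewrite /Om/= /eball/= subr0 => /ltW.
have C1y (V : set 'rV[R]_d.+2) : C1_on V y by exact: C1_shear.
have cy := @grad_shear_continuous R d.+2 a n w.
exists (shear_plus a n w), (shear_plus_grad a n w), y; split.
- apply: (@W1oo_shear_plus _ _ _ _ _ _ r); first exact: eball_open.
  by move=> x /OmE; apply: le_trans; exact: norm_le_enorm.
- by split => //; exists setT, y; split => //; exact: openT.
- move=> x clx.
  (* The gradient of [y] is continuous on the whole space, so its limit from inside is its value;
     the filter is proper because [x] lies in the closure. *)
  have -> : closure_grad [set x | Om x /\ 0 < F x] y x = grad y x.
    rewrite /closure_grad; case: ifP => // _.
    have pf : ProperFilter (within [set x | Om x /\ 0 < F x] (nbhs x)).
      exact: within_nbhs_proper.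
    apply: cvg_lim; first exact: norm_hausdorff.
    apply: cvg_within_filter; exact: cy.
  (* The determinant is that of [1 + a (x) n], namely [Delta], and the choice of [r] keeps the
     gradient in the ball of radius [eps]. *)
  apply: ball_K; split; last by rewrite /detset/= det_grad_shear.
  apply: Hr; apply: (@closure_ball_le _ _ r).
  by apply: closure_subset clx => u [].
- by move=> x [_ F0]; apply/matrixP => i j; rewrite mxE -/F F0.
- by move=> x [_ F0]; apply/matrixP => i j; rewrite !mxE -/F F0 ltNge (ltW F0).
Qed.
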